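(* Let $\mathfrak g$ be an untwisted affine Kac--Moody Lie algebra and let $\lambda\in\mathcal P^+$ be a regular dominant integral weight with $\langle\lambda,d\rangle=0$. Then the set of vertices of the dominant weight polyhedron $D_\lambda$ is equal to $\{\hat b_H(\lambda)\}_{H\subsetneq I}$, where $H$ ranges over all proper subsets of $I$ (including $\varnothing$).
   Context: $\mathfrak g$ is the untwisted affine Kac--Moody Lie algebra (conventions of Kac's book) of a finite-dimensional simple complex Lie algebra of rank $l$, with Cartan subalgebra $\mathfrak h$, derivation $d\in\mathfrak h$, $I=\{0,1,\dots,l\}$, simple roots $\alpha_i$, simple coroots $\alpha_i^\vee$, simple reflections $s_i$ generating the Weyl group $W$, basic imaginary root $\delta$. $\mathcal P^+=\{\lambda\in\mathfrak h^*:\langle\lambda,\alpha_i^\vee\rangle\in\mathbb Z_{\ge0}\ \forall i\in I\}$; $\lambda$ is regular dominant if $\langle\lambda,\alpha_i^\vee\rangle>0$ for all $i\in I$. Fundamental weights: $\langle\Lambda_i,\alpha_j^\vee\rangle=\delta_{ij}$, $\langle\Lambda_i,d\rangle=0$. $\mathfrak h^*_{\mathbb Q}=\bigoplus_{i\in I}\mathbb Q\Lambda_i\oplus\mathbb Q\delta$, and $\mathcal C_{\mathbb Q}=\{\mu\in\mathfrak h^*_{\mathbb Q}:\langle\mu,\alpha_i^\vee\rangle\ge0\ \forall i\in I\}$. Dominant weight polyhedron: $D_\lambda=\mathcal C_{\mathbb Q}\cap\operatorname{conv}_{\mathbb Q}\{w\lambda:w\in W\}$, where $\operatorname{conv}_{\mathbb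 Q}$ is the rational convex hull. It is a rational polyhedron; its vertices are its zero-dimensional faces. For $H\subsetneq I$, $W_H=\langle s_j:j\in H\rangle\subset W$ (a finite group) and $\hat b_H(\lambda)=\frac1{|W_H|}\sum_{w\in W_H}w(\lambda)$. *)

(* Defs.v *)
From HB Require Import structures.
From mathcomp Require Import all_boot all_order all_algebra.
From mathcomp Require Import finmap.
From mathcomp Require Import all_classical reals.
From mathcomp Require Import complex.

Set Implicit Arguments.
Unset Strict Implicit.
Unset Printing Implicit Defensive.

Import Order.TTheory GRing.Theory Num.Theory.
Local Open Scope classical_set_scope.
Local Open Scope ring_scope.

(* Throughout, Cartan matrices follow Kac: A i j = <alpha_i^vee, alpha_j>.    *)

Definition generalized_cartan_matrix (n : nat) (A : 'M[int]_n) : Prop :=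
  [/\ forall i, A i i = 2,
      forall i j, i != j -> A i j <= 0
    & forall i j, A i j = 0 -> A j i = 0].

Definition indecomposable_matrix (n : nat) (A : 'M[int]_n) : Prop :=
  (0 < n)%N /\
  forall J : {set 'I_n}, (exists i, i \in J) -> (exists j, j \notin J) ->
    exists i j, [/\ i \in J, j \notin J & A i j != 0].

Definition positive_definite_symmetrizable (n : nat) (A : 'M[int]_n) : Prop :=
  exists e : 'I_n -> rat,
    [/\ forall i, 0 < e i,
        forall i j, e i * (A i j)%:~R = e j * (A j i)%:~R
      & forall x : 'I_n -> rat, (exists i, x i != 0) ->
          0 < \sum_i \sum_j x i * (e i * (A i j)%:~R) * x j].

(* The Cartan matrices of the finite-dimensional simple Lie algebras.         *)
Definition simple_cartan_matrix (l : nat) (A : 'M[int]_l) : Prop :=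
  [/\ generalized_cartan_matrix A, indecomposable_matrix A
    & positive_definite_symmetrizable A].

(* [root_coroot A b bv]: b is a root and bv = b^vee its coroot, written in    *)
(* the bases of simple roots and of simple coroots: the pairs                 *)
(* (w alpha_i, w alpha_i^vee) with w in the finite Weyl group.                *)
Inductive root_coroot (l : nat) (A : 'M[int]_l) :
    'cV[int]_l -> 'cV[int]_l -> Prop :=
| RootSimple (i : 'I_l) : root_coroot A (delta_mx i 0) (delta_mx i 0)
| RootReflect (i : 'I_l) (b bv : 'cV[int]_l) : root_coroot A b bv ->
    root_coroot A (b - (A *m b) i 0 *: delta_mx i 0)
                  (bv - (A^T *m bv) i 0 *: delta_mx i 0).

Definition highest_root (l : nat) (A : 'M[int]_l) (theta thetav : 'cV[int]_l)
    : Prop :=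
  root_coroot A theta thetav /\
  forall b bv, root_coroot A b bv -> forall i, b i 0 <= theta i 0.

(* The matrix X_l^(1): alpha_0 = delta - theta and alpha_0^vee = K - theta^vee, *)
(* where delta and K pair to zero with all simple coroots, resp. roots; index *)
(* 0 is [lshift l 0] and index i >= 1 is [rshift 1 i].                        *)
Definition untwisted_affine_matrix (l : nat) (A : 'M[int]_l)
    (theta thetav : 'cV[int]_l) : 'M[int]_(1 + l) :=
  block_mx (2%:M) (- (thetav^T *m A)) (- (A *m theta)) A.

Section KacMoody.
Variable C : numFieldType.

Definition lie_bracket (g : lmodType C) (br : g -> g -> g) : Prop :=
  [/\ forall a x y z, br (a *: x + y) z = a *: br x z + br y z,
      forall a x y z, br z (a *: x + y) = a *: br z x + br z y,
      forall x, br x x = 0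
    & forall x y z, br x (br y z) + br y (br z x) + br z (br x y) = 0].

Definition linear_subset (g : lmodType C) (S : set g) : Prop :=
  S 0 /\ forall a x y, S x -> S y -> S (a *: x + y).

(* The Kac-Moody algebra g(A): a realization (h, roots, coroots) of A and the *)
(* Lie algebra generated by h and Chevalley generators with no nonzero ideal  *)
(* meeting h trivially, which characterizes g(A) (Kac, Proposition 1.4).      *)
Record kac_moody (n : nat) (A : 'M[int]_n) := KacMoody {
  km_cartan : vectType C;
  km_coroot : 'I_n -> km_cartan;
  km_root : 'I_n -> 'Hom(km_cartan, C^o);
  km_coroot_free : free [seq km_coroot i | i <- enum 'I_n];
  km_root_free : free [seq km_root i | i <- enum 'I_n];
  km_pairing : forall i j, km_root j (km_coroot i) = (A i j)%:~R;
  km_dim : (\dim {: km_cartan} + \rank (map_mx (intr : int -> C) A) = n + n)%N;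
  km_lie : lmodType C;
  km_br : km_lie -> km_lie -> km_lie;
  km_brP : lie_bracket km_br;
  km_incl : {linear km_cartan -> km_lie};
  km_incl_inj : injective km_incl;
  km_e : 'I_n -> km_lie;
  km_f : 'I_n -> km_lie;
  km_brhh : forall x y, km_br (km_incl x) (km_incl y) = 0;
  km_brhe : forall x i,
    km_br (km_incl x) (km_e i) = (km_root i x : C) *: km_e i;
  km_brhf : forall x i,
    km_br (km_incl x) (km_f i) = - (km_root i x : C) *: km_f i;
  km_bref : forall i j,
    km_br (km_e i) (km_f j) = if i == j then km_incl (km_coroot i) else 0;
  km_gen : forall S : set km_lie, linear_subset S ->
    (forall x y, S x -> S y -> S (km_br x y)) ->
    (forall x, S (km_incl x)) -> (forall i, S (km_e i)) ->
    (forall i, S (km_f i)) -> forall x, S x;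
  km_ideal : forall S : set km_lie, linear_subset S ->
    (forall x y, S y -> S (km_br x y)) ->
    (forall x, S (km_incl x) -> x = 0) -> forall x, S x -> x = 0
}.

Section Weights.
Variables (n : nat) (A : 'M[int]_n) (g : kac_moody A).

Definition dual_cartan : vectType C := 'Hom(km_cartan g, C^o).

Definition pairing (mu : dual_cartan) (x : km_cartan g) : C := mu x.

Definition reflection_fun (i : 'I_n) (mu : dual_cartan) : dual_cartan :=
  mu - pairing mu (km_coroot g i) *: km_root g i.

Lemma reflection_fun_is_linear i : linear (reflection_fun i).
Proof.
move=> a u v; rewrite /reflection_fun /pairing add_lfunE scale_lfunE.
by rewrite scalerDl scalerBr scalerA opprD addrACA.
Qed.

HB.instance Definition _ i := GRing.isLinear.Build C dual_cartan dual_cartan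
  *:%R (reflection_fun i) (reflection_fun_is_linear i).

Definition reflection (i : 'I_n) : 'End(dual_cartan) :=
  linfun (reflection_fun i).

Definition weyl_word (js : seq 'I_n) : 'End(dual_cartan) :=
  foldr (fun j w => (reflection j \o w)%VF) \1%VF js.

(* W_H; the generators are involutions, so products of generators suffice.    *)
Definition parabolic (H : {set 'I_n}) : set 'End(dual_cartan) :=
  [set w | exists2 js : seq 'I_n, all (fun j => j \in H) js & w = weyl_word js].

Definition weyl_group : set 'End(dual_cartan) := parabolic finset.setT.

Definition weyl_orbit (lambda : dual_cartan) : set dual_cartan :=
  [set w lambda | w in weyl_group].

(* [fset_set] enumerates a finite set; W_H is finite for H proper, A affine.  *)
Definition bhat (H : {set 'I_n}) (lambda : dual_cartan) : dual_cartan :=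
  (#|` fset_set (parabolic H)|%:R : C)^-1 *:
    \sum_(w <- fset_set (parabolic H)) (w : 'End(dual_cartan)) lambda.

Definition dominant_integral (lambda : dual_cartan) : Prop :=
  forall i, exists m : nat, pairing lambda (km_coroot g i) = m%:R.

Definition regular_dominant (lambda : dual_cartan) : Prop :=
  forall i, 0 < pairing lambda (km_coroot g i).

Definition fundamental_weights (d : km_cartan g) (Lam : 'I_n -> dual_cartan)
    : Prop :=
  (forall i j, pairing (Lam i) (km_coroot g j) = (i == j)%:R) /\
  (forall i, pairing (Lam i) d = 0).

Definition rational_weights (Lam : 'I_n -> dual_cartan) (delta : dual_cartan)
    : set dual_cartan :=
  [set mu | exists (c : 'I_n -> rat) (b : rat),
    mu = \sum_i (ratr (c i) : C) *: Lam i + (ratr b : C) *: delta].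

(* The cone C_Q, for U = h^*_Q.                                               *)
Definition rational_dominant (U : set dual_cartan) : set dual_cartan :=
  [set mu | U mu /\ forall i, 0 <= pairing mu (km_coroot g i)].

End Weights.

Definition conv_rat (V : lmodType C) (S : set V) : set V :=
  [set v | exists (m : nat) (c : 'I_m -> rat) (x : 'I_m -> V),
    [/\ forall k, 0 <= c k, \sum_k c k = 1, forall k, S (x k)
      & v = \sum_k (ratr (c k) : C) *: x k]].

Definition rational_linear_on (V : lmodType C) (U : set V) (f : V -> rat)
    : Prop :=
  forall a u v, U u -> U v -> f ((ratr a : C) *: u + v) = a * f u + f v.

(* Nonempty faces of a polyhedron P in the rational vector space U: the loci  *)
(* where a Q-linear functional on U attains its maximum on P (f = 0 gives P). *)
Definition is_face (V : lmodType C) (U P F : set V) : Prop :=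
  F !=set0 /\
  exists (f : V -> rat) (c : rat),
    [/\ rational_linear_on U f, forall x, P x -> f x <= c
      & F = P `&` [set x | f x = c]].

(* A face has dimension zero when it is a single point.                       *)
Definition vertices (V : lmodType C) (U P : set V) : set V :=
  [set v | is_face U P [set v]].

Definition dominant_weight_polyhedron (n : nat) (A : 'M[int]_n)
    (g : kac_moody A) (U : set (dual_cartan g)) (lambda : dual_cartan g)
    : set (dual_cartan g) :=
  rational_dominant U `&` conv_rat (weyl_orbit lambda).

(* delta = alpha_0 + theta.                                                   *)
Definition basic_imaginary_root (l : nat) (A : 'M[int]_l)
    (theta thetav : 'cV[int]_l)
    (g : kac_moody (untwisted_affine_matrix A theta thetav)) : dual_cartan g :=
  km_root g (lshift l 0) +
  \sum_(i < l) ((theta i 0)%:~R : C) *: km_root g (rshift 1 i).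

(* The defining property of the derivation d in Kac's conventions.            *)
Definition is_derivation_element (l : nat) (A : 'M[int]_(1 + l))
    (g : kac_moody A) (d : km_cartan g) : Prop :=
  forall i : 'I_(1 + l), pairing (km_root g i) d = (i == lshift l 0)%:R.

End KacMoody.

(* Main.v *)
(** Write a point of D_lambda as lambda - sum_j c_j alpha_j.  Orbit points have
    c >= 0, so D_lambda lies in the polyhedron {c >= 0, A c <= m}, where m_j is
    the pairing of lambda with the j-th simple coroot.  A symmetrized affine
    matrix S is a singular M-matrix whose proper principal submatrices are
    inverse-monotone; hence, for H proper, W_H is finite and bhat_H(lambda) is
    the point with c_j = 0 off H and (A c)_j = m_j on H, and it is exposed by
    the functional summing these constraints.

    Conversely let f be maximal on D_lambda exactly at v.  Since lambda - k delta
    is the midpoint of s_0 s_theta lambda and s_theta s_0 lambda, D_lambda is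
    stable under subtracting k delta, so f(delta) >= 0.  This makes the linear
    complementarity problem for S with data f(alpha_j) solvable, and a solution
    with support H certifies that f is maximal at bhat_H(lambda), so
    v = bhat_H(lambda).

    The inclusion c >= 0 for orbit points uses the exchange argument for words
    in W and the sign-coherence of real roots; the latter holds because the
    positive and negative parts of a root b have norms that are even multiples
    of (b|b) / 2 and add up to at most (b|b). *)
Require Import Defs.
From HB Require Import structures.
From mathcomp Require Import all_boot all_order all_algebra.
From mathcomp Require Import finmap.
From mathcomp Require Import all_classical reals.
From mathcomp Require Import complex.
From mathcomp Require Import zify ring lra.

Import Order.TTheory GRing.Theory Num.Theory.
Local Open Scope classical_set_scope.
Local Open Scope ring_scope.

(** * Singular symmetric M-matrices and the linear complementarity problem *)

Definition mxapp {n : nat} (S : 'M[rat]_n) (x : 'I_n -> rat) (i : 'I_n) : rat :=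
  \sum_j S i j * x j.

Definition mxform {n : nat} (S : 'M[rat]_n) (x y : 'I_n -> rat) : rat :=
  \sum_i x i * mxapp S y i.

(** The codomain is left open because it serves both for rational vectors and for the integer
    coordinates of orbit points. *)
Definition supported {n : nat} {T : nmodType} (H : {set 'I_n}) (x : 'I_n -> T) :=
  forall j, j \notin H -> x j = 0.

(** A singular symmetric M-matrix with positive null vector [a]; [form_indec] is connectedness of
    the Dynkin diagram. *)
Record affine_form {n : nat} (S : 'M[rat]_n) (a : 'I_n -> rat) : Prop :=
  AffineForm {
  form_sym : forall i j, S i j = S j i;
  form_off : forall i j, i != j -> S i j <= 0;
  form_diag : forall i, 0 < S i i;
  null_gt0 : forall i, 0 < a i;
  form_null : forall i, mxapp S a i = 0;
  form_indec : forall J : {set 'I_n},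
    (exists i, i \in J) -> (exists j, j \notin J) ->
    exists i j, [/\ i \in J, j \notin J & S i j != 0] }.

Section AffineForm.
Variables (n : nat) (S : 'M[rat]_n) (a : 'I_n -> rat).
Hypothesis affS : affine_form S a.

Lemma mxappD x y i :
  mxapp S (fun j => x j + y j) i = mxapp S x i + mxapp S y i.
Proof. by rewrite /mxapp -big_split; apply: eq_bigr => j _; rewrite mulrDr. Qed.

Lemma mxappZ t x i : mxapp S (fun j => t * x j) i = t * mxapp S x i.
Proof. by rewrite /mxapp mulr_sumr; apply: eq_bigr => j _; rewrite mulrCA. Qed.

Lemma mxappDZ t x y i :
  mxapp S (fun j => x j + t * y j) i = mxapp S x i + t * mxapp S y i.
Proof. by rewrite mxappD mxappZ. Qed.

Lemma mxapp_delta k i : mxapp S (fun j => (j == k)%:R) i = S i k.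
Proof.
rewrite /mxapp (bigD1 k) //= eqxx mulr1 big1 ?addr0 // => j /negPf ->.
by rewrite mulr0.
Qed.

Lemma mxformC x y : mxform S x y = mxform S y x.
Proof.
rewrite /mxform /mxapp; under eq_bigr do rewrite mulr_sumr.
under [RHS]eq_bigr do rewrite mulr_sumr.
rewrite exchange_big; apply: eq_bigr => i _; apply: eq_bigr => j _.
by rewrite (form_sym _ _ affS j i); ring.
Qed.

Lemma mxform_deltal k y : mxform S (fun j => (j == k)%:R) y = mxapp S y k.
Proof.
rewrite /mxform (bigD1 k) //= eqxx mul1r big1 ?addr0 // => j /negPf ->.
by rewrite mul0r.
Qed.

Lemma mxformDZl t x y z :
  mxform S (fun j => x j + t * y j) z = mxform S x z + t * mxform S y z.
Proof.
rewrite /mxform mulr_sumr -big_split; apply: eq_bigr => i _ /=.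
by rewrite mulrDl mulrA.
Qed.

Lemma mxform_quad t x y :
  mxform S (fun j => x j + t * y j) (fun j => x j + t * y j) =
  mxform S x x + 2 * t * mxform S x y + t ^+ 2 * mxform S y y.
Proof.
rewrite mxformDZl (mxformC x) (mxformC y) !mxformDZl (mxformC y x).
by ring.
Qed.

Lemma mxform_null x : mxform S a x = 0.
Proof.
by rewrite mxformC /mxform big1 // => i _; rewrite (form_null _ _ affS) mulr0.
Qed.

(* Writing x = a y, the form is the sum of squares
   - 1/2 sum_(i, j) S_ij a_i a_j (y_i - y_j)^2. *)
Lemma mxform_ge0 x : 0 <= mxform S x x.
Proof.
pose y i := x i / a i.
have xE i : x i = a i * y i.
  by rewrite /y mulrCA mulfV ?mulr1 // gt_eqF // (null_gt0 _ _ affS).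
have sq : \sum_i \sum_j S i j * a i * a j * (y i - y j) ^+ 2 =
          - 2 * mxform S x x.
  have T1 : \sum_i \sum_j S i j * a i * a j * y i ^+ 2 = 0.
    rewrite big1 // => i _.
    transitivity (a i * y i ^+ 2 * mxapp S a i).
      by rewrite /mxapp mulr_sumr; apply: eq_bigr => j _; ring.
    by rewrite (form_null _ _ affS) mulr0.
  have T2 : \sum_i \sum_j S i j * a i * a j * y j ^+ 2 = 0.
    rewrite exchange_big -[RHS]T1; apply: eq_bigr => i _; apply: eq_bigr => j _.
    by rewrite (form_sym _ _ affS j i); ring.
  transitivity (\sum_i \sum_j S i j * a i * a j * y i ^+ 2 +
                \sum_i \sum_j S i j * a i * a j * y j ^+ 2 - 2 * mxform S x x).
    rewrite /mxform /mxapp mulr_sumr -sumrN -!big_split; apply: eq_bigr => i _ /=.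
    rewrite mulr_sumr mulr_sumr -sumrN -!big_split; apply: eq_bigr => j _ /=.
    by rewrite !xE; ring.
  by rewrite T1 T2; ring.
have : \sum_i \sum_j S i j * a i * a j * (y i - y j) ^+ 2 <= 0.
  apply: sumr_le0 => i _; apply: sumr_le0 => j _.
  have [->|ij] := eqVneq i j; first by rewrite subrr expr0n mulr0.
  apply: mulr_le0_ge0 (sqr_ge0 _).
  apply: mulr_le0_ge0 (ltW (null_gt0 _ _ affS _)).
  apply: mulr_le0_ge0 (ltW (null_gt0 _ _ affS _)).
  exact: form_off affS _ _ ij.
by rewrite sq; lra.
Qed.

(** A zero of a nonnegative quadratic form is a minimum, so the gradient, which is proportional to S
    x, vanishes there. *)
Lemma mxform_eq0 x : mxform S x x = 0 -> forall i, mxapp S x i = 0.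
Proof.
move=> x0 i; have d0 := form_diag _ _ affS i.
(* The minimizer of the form on the line through x in direction i; the minimum is -(S x)_i^2 /
   S_ii. *)
pose t := - (mxapp S x i / S i i).
have := mxform_ge0 (fun j => x j + t * (j == i)%:R).
rewrite mxform_quad x0 mxformC !mxform_deltal mxapp_delta add0r.
have -> : 2 * t * mxapp S x i + t ^+ 2 * S i i = - (mxapp S x i ^+ 2 / S i i).
  by rewrite /t; field; rewrite gt_eqF.
rewrite oppr_ge0 pmulr_lle0 ?invr_gt0 // => le0.
by apply/eqP; rewrite -sqrf_eq0 eq_le le0 sqr_ge0.
Qed.

(* Subtracting from u its smallest multiple s a of the null vector, the set
   where u = s a would disconnect S. *)
Lemma mxapp_monotone (H : {set 'I_n}) (u : 'I_n -> rat) :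
  (exists j, j \notin H) -> supported H u ->
  (forall j, j \in H -> 0 <= mxapp S u j) -> forall j, 0 <= u j.
Proof.
move=> [k0 k0H] uH Su j; rewrite leNgt; apply/negP => uj.
have a0 := null_gt0 _ _ affS.
have [j0 _ j0min] := @arg_minP _ _ _ j xpredT (fun k => u k / a k) isT.
set s := u j0 / a j0 in j0min.
have s0 : s < 0.
  by apply: le_lt_trans (j0min j isT) _; rewrite pmulr_llt0 ?invr_gt0.
have w0 k : 0 <= u k - s * a k.
  by rewrite subr_ge0 -ler_pdivlMr // j0min.
have sa k : s * a k < 0 by rewrite pmulr_llt0.
have [||i [k [iJ kJ Sik]]] :=
    form_indec _ _ affS [set k | u k == s * a k]%SET.
- by exists j0; rewrite inE /s divfK // gt_eqF.
- by exists k0; rewrite inE uH // eq_sym lt_eqF.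
move: iJ kJ; rewrite !inE => /eqP ui uk.
have iH : i \in H by apply/negPn/negP => /uH u0; have := sa i; rewrite -ui u0 ltxx.
have ik : i != k by apply: contraNneq uk => <-; rewrite ui.
(* Expanding (S u)_i = (S (u - s a))_i: the term at i vanishes because u = s a there, the other
   terms are nonpositive, and the one at k is negative. *)
have : 0 <= mxapp S (fun k => u k + (- s) * a k) i.
  by rewrite mxappDZ (form_null _ _ affS) mulr0 addr0 Su.
rewrite /mxapp (bigD1 k) //= leNgt; apply/negP/negPn.
rewrite -[ltRHS]addr0 ltr_leD //.
  rewrite nmulr_rlt0; last by rewrite lt_neqAle Sik (form_off _ _ affS).
  by rewrite mulNr lt_neqAle w0 andbT eq_sym subr_eq0.
apply: sumr_le0 => m _; have [<-|im] := eqVneq i m.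
  by rewrite mulNr ui subrr mulr0.
by rewrite mulr_le0_ge0 ?(form_off _ _ affS) // mulNr.
Qed.

(** Monotonicity applied to both u and -u. *)
Lemma mxapp_inj (H : {set 'I_n}) (u : 'I_n -> rat) :
  (exists j, j \notin H) -> supported H u ->
  (forall j, j \in H -> mxapp S u j = 0) -> forall j, u j = 0.
Proof.
move=> pH uH Su j; apply/eqP; rewrite eq_le -oppr_ge0 andbC.
apply/andP; split; first by apply: (mxapp_monotone H) => // k kH; rewrite Su.
have -> : - u j = (-1) * u j by ring.
apply: (mxapp_monotone H (fun j => (-1) * u j)) => // k kH; last first.
  by rewrite mxappZ Su // mulr0.
by rewrite uH ?mulr0.
Qed.

(** Uniqueness gives existence: the square matrix [B], with the rows of S on H and identity rows off
    H, has trivial kernel by [mxapp_inj]. *)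
Lemma mxapp_solve (H : {set 'I_n}) (y : 'I_n -> rat) :
  (exists j, j \notin H) ->
  exists2 u, supported H u & forall j, j \in H -> mxapp S u j = y j.
Proof.
move=> pH.
pose B : 'M[rat]_n :=
  \matrix_(i, j) if i \in H then S i j else (i == j)%:R.
have appB (x : 'cV_n) i :
    (B *m x) i 0 = if i \in H then mxapp S (x^~ 0) i else x i 0.
  rewrite mxE; under eq_bigr do rewrite mxE.
  case: ifP => iH; first by apply: eq_bigr.
  rewrite (bigD1 i) //= eqxx mul1r big1 ?addr0 // => j.
  by rewrite eq_sym => /negPf ->; rewrite mul0r.
have uB : B \in unitmx.
  rewrite -unitmx_tr -row_free_unit -kermx_eq0; apply/eqP/row_matrixP => i.
  rewrite row0; set v := row i _.
  have Bv : B *m v^T = 0.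
    by rewrite -[B]trmxK -trmx_mul /v -row_mul mulmx_ker row0 trmx0.
  have v0 : forall j, v^T j 0 = 0.
    apply: (mxapp_inj H) => // j jH; have := appB v^T j; rewrite Bv mxE.
      by rewrite (negPf jH).
    by rewrite jH.
  by apply/rowP => j; have := v0 j; rewrite !mxE.
pose x := invmx B *m (\col_j if j \in H then y j else 0).
have Bx : B *m x = \col_j (if j \in H then y j else 0) by rewrite mulKVmx.
exists (x^~ 0) => j jH; have := appB x j; rewrite Bx mxE.
  by rewrite (negPf jH).
by rewrite jH.
Qed.

(** If h is supported on H and S h is the k-th unit vector on H, then x_k = (x|h), and nonnegativity
    of the form at x + h and x - h bounds |x_k| by the norms of x and h. *)
Lemma supported_bound (H : {set 'I_n}) k :
  (exists j, j \notin H) ->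
  exists B, forall x, supported H x -> `|x k| <= mxform S x x + B.
Proof.
move=> pH; have [h hH hk] := mxapp_solve H (fun j => (j == k)%:R) pH.
exists (mxform S h h) => x xH.
have [kH|kH] := boolP (k \in H); last first.
  by rewrite xH // normr0 addr_ge0 // mxform_ge0.
have xkE : mxform S x h = x k.
  rewrite /mxform (bigD1 k) //= hk // eqxx mulr1 big1 ?addr0 // => j /negPf jk.
  by have [jH|jH] := boolP (j \in H); [rewrite hk // jk mulr0|rewrite xH ?mul0r].
have := mxform_ge0 (fun j => x j + 1 * h j).
have := mxform_ge0 (fun j => x j + (-1) * h j).
have := mxform_ge0 x; have := mxform_ge0 h.
rewrite !mxform_quad xkE => h1 h2 h3 h4.
by rewrite ler_norml; apply/andP; split; lra.
Qed.

(* The linear complementarity problem: enlarge the support H by the indices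
   where q + S v is negative; [mxapp_monotone] keeps v nonnegative, and pairing
   with the null vector keeps H proper. *)
Lemma complementarity (q : 'I_n -> rat) :
  (0 < n)%N -> 0 <= \sum_j q j * a j ->
  exists (H : {set 'I_n}) (v : 'I_n -> rat),
    [/\ exists j, j \notin H, supported H v, forall j, 0 <= v j,
        forall j, j \in H -> q j + mxapp S v j = 0
      & forall j, 0 <= q j + mxapp S v j].
Proof.
move=> n0 qa.
(* Induction on the number of indices outside H, which drops at each enlargement of the support. *)
suff grow : forall (m : nat) (H : {set 'I_n}) (v : 'I_n -> rat), (#|~: H| <= m)%N ->
    [/\ exists j, j \notin H, supported H v, forall j, 0 <= v j
      & forall j, j \in H -> q j + mxapp S v j = 0] ->
  exists (H : {set 'I_n}) (v : 'I_n -> rat),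
    [/\ exists j, j \notin H, supported H v, forall j, 0 <= v j,
        forall j, j \in H -> q j + mxapp S v j = 0
      & forall j, 0 <= q j + mxapp S v j].
  apply: (grow _ finset.set0 (fun=> 0) (leqnn _)); split => //.
    by exists (Ordinal n0); rewrite inE.
  by move=> j; rewrite inE.
elim=> [|m IHm] H v.
  by rewrite leqn0 cards_eq0 => /eqP H0 [[j]]; rewrite -finset.in_setC H0 inE.
move=> Hm [pH vH v0 yH]; pose y j := q j + mxapp S v j.
have [/forallP y0|] := boolP [forall j, 0 <= y j]; first by exists H, v.
rewrite negb_forall => /existsP[j0]; rewrite -ltNge => yj0.
pose H' := H :|: [set j | y j < 0]%SET.
have j0H : j0 \notin H by apply: contraL yj0 => /yH yj; rewrite /y yj ltxx.
have pH' : exists j, j \notin H'.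
  apply/existsP; rewrite -negb_forall; apply/negP => /forallP full.
  have : \sum_j y j * a j < 0.
    rewrite (bigD1 j0) //= -[ltRHS]addr0 ltr_leD //.
      by rewrite pmulr_llt0 // (null_gt0 _ _ affS).
    apply: sumr_le0 => j _; rewrite pmulr_lle0 ?(null_gt0 _ _ affS) //.
    by have := full j; rewrite !inE => /orP[/yH yj|/ltW//]; rewrite /y yj.
  have -> : \sum_j y j * a j = \sum_j q j * a j + mxform S a v.
    by rewrite /mxform -big_split; apply: eq_bigr => j _ /=; rewrite /y; ring.
  by rewrite mxform_null addr0 ltNge qa.
have [u uH' uE] := mxapp_solve H' (fun j => - q j) pH'.
have vH' : supported H' v.
  by move=> j; rewrite !inE negb_or => /andP[jH _]; exact: vH.
apply: (IHm H' u); last split => //.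
- rewrite -ltnS; apply: leq_trans Hm; apply: proper_card.
  rewrite properE finset.setCS finset.subsetUl finset.setCS /=; apply/subsetPn.
  by exists j0; rewrite ?inE ?yj0 ?orbT.
- move=> j; have d0 : 0 <= u j + (-1) * v j.
    apply: (mxapp_monotone H' (fun j => u j + (-1) * v j)) => //.
      by move=> k kH; rewrite uH' // vH' // mulr0 addr0.
    move=> k kH; rewrite mxappDZ uE //.
    have yk : y k <= 0.
      by move: kH; rewrite !inE => /orP[/yH|/ltW//]; rewrite /y => ->.
    by move: yk; rewrite /y; lra.
  by have := v0 j; lra.
- by move=> j jH; rewrite uE // subrr.
Qed.

End AffineForm.

(** * Symmetrizable affine Cartan matrices *)

Record affine_cartan {n : nat} (A : 'M[int]_n) (e a : 'I_n -> rat) : Prop :=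
  AffineCartan {
  cartan_diag : forall i, A i i = 2;
  cartan_off : forall i j, i != j -> A i j <= 0;
  symmetrizer_gt0 : forall i, 0 < e i;
  cartan_sym : forall i j, e i * (A i j)%:~R = e j * (A j i)%:~R;
  cartan_null_gt0 : forall i, 0 < a i;
  cartan_null : forall i, \sum_j (A i j)%:~R * a j = 0;
  cartan_indec : forall J : {set 'I_n},
    (exists i, i \in J) -> (exists j, j \notin J) ->
    exists i j, [/\ i \in J, j \notin J & A i j != 0] }.

Definition symform {n : nat} (A : 'M[int]_n) (e : 'I_n -> rat) : 'M[rat]_n :=
  \matrix_(i, j) (e i * (A i j)%:~R).

Lemma mxapp_symform {n : nat} (A : 'M[int]_n) (e x : 'I_n -> rat) i :
  mxapp (symform A e) x i = e i * \sum_j (A i j)%:~R * x j.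
Proof.
by rewrite /mxapp mulr_sumr; apply: eq_bigr => j _; rewrite mxE mulrA.
Qed.

Lemma affine_symform {n : nat} {A : 'M[int]_n} {e a : 'I_n -> rat} :
  affine_cartan A e a -> affine_form (symform A e) a.
Proof.
move=> affA; have e0 := symmetrizer_gt0 _ _ _ affA.
split=> [i j|i j ij|i|i|i|J J1 J2].
- by rewrite !mxE (cartan_sym _ _ _ affA).
- by rewrite mxE pmulr_rle0 // lerz0 (cartan_off _ _ _ affA).
- by rewrite mxE (cartan_diag _ _ _ affA) mulr_gt0.
- exact: cartan_null_gt0 affA i.
- by rewrite mxapp_symform (cartan_null _ _ _ affA) mulr0.
- have [i [j [iJ jJ Aij]]] := cartan_indec _ _ _ affA J J1 J2.
  by exists i, j; split => //; rewrite mxE mulf_neq0 ?intr_eq0 // gt_eqF.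
Qed.

(** * Sign-coherence of real roots and coordinates of orbit points *)

Section Roots.
Variables (n : nat) (A : 'M[int]_n).
Implicit Types b bv c : 'cV[int]_n.

Lemma app_delta (x : 'rV[int]_n) i : (x *m (delta_mx i 0 : 'cV_n)) 0 0 = x 0 i.
Proof. by rewrite -colE !mxE. Qed.

Lemma delta_dot (x : 'cV[int]_n) i : ((delta_mx i 0 : 'cV_n)^T *m x) 0 0 = x i 0.
Proof. by rewrite trmx_delta -rowE !mxE. Qed.

Lemma mulmx_dot_tr bv i : (bv^T *m A) 0 i = (A^T *m bv) i 0.
Proof. by rewrite -[in RHS](trmxK bv) -trmx_mul [RHS]mxE. Qed.

(** With y and z the pairings of b^vee with alpha_i and of alpha_i^vee with b, reflecting both
    changes the pairing of b^vee with b by -yz - yz + 2yz = 0. *)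
Lemma root_pairing b bv :
  (forall i, A i i = 2) -> root_coroot A b bv -> (bv^T *m A *m b) 0 0 = 2.
Proof.
move=> A2; elim=> {b bv} [i|i b bv _ IH].
  by rewrite app_delta trmx_delta -rowE !mxE A2.
set z := (A *m b) i 0; set y := (A^T *m bv) i 0.
have -> : (bv - y *: delta_mx i 0)^T = bv^T - y *: (delta_mx i 0)^T.
  by rewrite linearB linearZ.
rewrite !(mulmxBl, mulmxBr) -!scalemxAl -!scalemxAr.
have E1 : (bv^T *m A *m (delta_mx i 0 : 'cV_n)) 0 0 = y by rewrite app_delta mulmx_dot_tr.
have E2 : ((delta_mx i 0 : 'cV_n)^T *m A *m b) 0 0 = z by rewrite -mulmxA delta_dot.
have E3 : ((delta_mx i 0 : 'cV_n)^T *m A *m (delta_mx i 0 : 'cV_n)) 0 0 = 2.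
  by rewrite app_delta trmx_delta -rowE mxE A2.
have ent (X Y : 'M[int]_1) : (X - Y) 0 0 = X 0 0 - Y 0 0 by rewrite !mxE.
have entZ t (X : 'M[int]_1) : (t *: X) 0 0 = t * X 0 0 by rewrite mxE.
by rewrite !(ent, entZ) IH E1 E2 E3; ring.
Qed.

Lemma proportional_app (e : 'I_n -> rat) (t : rat) b bv i :
  (forall i j, e i * (A i j)%:~R = e j * (A j i)%:~R) ->
  (forall j, t * (bv j 0)%:~R = e j * (b j 0)%:~R) ->
  t * ((A^T *m bv) i 0)%:~R = e i * ((A *m b) i 0)%:~R.
Proof.
move=> eA tE; rewrite !mxE !rmorph_sum /= !mulr_sumr; apply: eq_bigr => k _.
by rewrite !mxE !intrM mulrCA tE [RHS]mulrA eA; ring.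
Qed.

(** The factor t plays the role of (b|b) / 2: it is e_i at a simple root and is unchanged by
    reflections. In particular b and b^vee have the same signs. *)
Lemma root_proportional (e : 'I_n -> rat) b bv :
  (forall i, 0 < e i) ->
  (forall i j, e i * (A i j)%:~R = e j * (A j i)%:~R) -> root_coroot A b bv ->
  exists2 t : rat, 0 < t & forall j, t * (bv j 0)%:~R = e j * (b j 0)%:~R.
Proof.
move=> e0 eA; elim=> {b bv} [i|i b bv _ [t t0 IH]].
  exists (e i) => // j; rewrite mxE andbT; have [->//|_] := eqVneq j i.
  by rewrite !mulr0.
exists t => // j.
have := proportional_app e t b bv i eA IH.
move: ((A^T *m bv) i 0) ((A *m b) i 0) => y z tA.
rewrite !mxE andbT; have [->|_] := eqVneq j i; last first.
  by rewrite !mulr0 !subr0 IH.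
by rewrite !mulr1 !rmorphB /= !mulrBr IH tA.
Qed.

(** The off-diagonal terms come in equal pairs. *)
Lemma symmetric_sum_even (I : Type) (r : seq I) (F : I -> I -> int) :
  (forall i j, F i j = F j i) -> (forall i, exists m, F i i = 2 * m) ->
  exists m, \sum_(i <- r) \sum_(j <- r) F i j = 2 * m.
Proof.
move=> Fsym Fdiag; elim: r => [|x r [m IH]]; first by exists 0; rewrite big_nil.
have [k Fk] := Fdiag x; exists (k + \sum_(j <- r) F x j + m).
rewrite big_cons; under [X in _ + X]eq_bigr do rewrite big_cons.
rewrite big_split /= IH big_cons Fk.
under [X in _ + (X + _)]eq_bigr do rewrite Fsym.
by ring.
Qed.

Variables e a : 'I_n -> rat.
Hypothesis affA : affine_cartan A e a.
Let A2 := cartan_diag _ _ _ affA.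
Let e0 := symmetrizer_gt0 _ _ _ affA.
Let affS := affine_symform affA.

(* For a restriction x of the root b to a set of simple roots, (x|x) is an even
   nonnegative multiple of (b|b) / 2. *)
Lemma root_part_norm b bv (P : {set 'I_n}) :
  root_coroot A b bv ->
  let N := \sum_i \sum_j (if i \in P then bv i 0 else 0) * A i j *
                         (if j \in P then b j 0 else 0) in
  [/\ 0 <= N, exists m, N = 2 * m &
      N = 0 -> (exists j, j \notin P) -> forall j, j \in P -> b j 0 = 0].
Proof.
move=> rb N; have [t t0 tE] := root_proportional _ _ _ e0 (cartan_sym _ _ _ affA) rb.
pose x i : rat := (if i \in P then b i 0 else 0)%:~R.
have xE i : e i * x i = t * (if i \in P then bv i 0 else 0)%:~R.
  by rewrite /x; case: ifP; rewrite ?mulr0 // tE.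
have NE : t * N%:~R = mxform (symform A e) x x.
  rewrite /N /mxform rmorph_sum mulr_sumr /=; apply: eq_bigr => i _.
  rewrite mxapp_symform mulrCA mulrA xE -mulrA; congr (_ * _).
  rewrite rmorph_sum /= mulr_sumr; apply: eq_bigr => j _.
  by rewrite !intrM mulrA.
split.
- by rewrite -(@ler0z rat) -(pmulr_rge0 _ t0) NE (mxform_ge0 _ _ _ affS).
- apply: symmetric_sum_even => [i j|i]; last first.
    by eexists; rewrite A2 mulrAC mulrC.
  apply: (@intr_inj rat); apply: (mulfI (lt0r_neq0 t0)).
  rewrite !intrM !mulrA -!xE -/(x i) -/(x j).
  transitivity (e i * (A i j)%:~R * (x i * x j)); first by ring.
  by rewrite (cartan_sym _ _ _ affA); ring.
(* Norm zero puts x in the kernel of S, and S is injective on vectors supported in a proper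
   subset. *)
- move=> N0 pP j jP; apply: (@intr_inj rat).
  have x0 := mxform_eq0 _ _ _ affS x.
  have : x j = 0.
    apply: (mxapp_inj _ _ _ affS P) => // [k kP|k _]; last first.
      by apply: x0; rewrite -NE N0 mulr0.
    by rewrite /x (negPf kP).
  by rewrite /x jP.
Qed.

(** Expand the pairing 2 of b^vee with b over the positive part P and its complement. The cross
    terms are nonnegative because A_ij <= 0 there, so [NP + NQ <= 2]; both being even and
    nonnegative, one of them is 0. *)
Lemma root_sign b bv : root_coroot A b bv ->
  (forall j, 0 <= b j 0) \/ (forall j, b j 0 <= 0).
Proof.
move=> rb; have [t t0 tE] := root_proportional _ _ _ e0 (cartan_sym _ _ _ affA) rb.
pose P := [set i | 0 < b i 0]%SET.
have [NP0 [m NPE] NPz] := root_part_norm _ _ P rb.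
have [NQ0 [k NQE] NQz] := root_part_norm _ _ (~: P)%SET rb.
have bv0 i : (0 <= bv i 0) = (0 <= b i 0).
  by rewrite -(@ler0z rat) -(pmulr_rge0 _ t0) tE pmulr_rge0 // ler0z.
have bvn i : (bv i 0 <= 0) = (b i 0 <= 0).
  by rewrite -(@lerz0 rat) -(pmulr_rle0 _ t0) tE pmulr_rle0 // lerz0.
set NP := (X in 0 <= X) in NP0 NPE NPz; set NQ := (X in 0 <= X) in NQ0 NQE NQz.
have NPQ : NP + NQ <= 2.
  rewrite -(root_pairing _ _ A2 rb) -subr_ge0.
  have -> : (bv^T *m A *m b) 0 0 = \sum_i \sum_j bv i 0 * A i j * b j 0.
    rewrite -mulmxA mxE; apply: eq_bigr => i _; rewrite !mxE mulr_sumr.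
    by apply: eq_bigr => j _; rewrite mulrA.
  rewrite /NP /NQ -big_split -sumrB; apply: sumr_ge0 => i _.
  rewrite -big_split -sumrB; apply: sumr_ge0 => j _ /=.
  rewrite !inE; have [bi|bi] := ltrP 0 (b i 0); have [bj|bj] := ltrP 0 (b j 0);
    rewrite /= ?mulr0 ?mul0r ?addr0 ?add0r ?subrr ?subr0 //.
  - have ij : i != j by apply: contraTneq bi => ->; rewrite -leNgt.
    apply: mulr_le0 => //; apply: mulr_ge0_le0 (cartan_off _ _ _ affA _ _ ij).
    by rewrite bv0 ltW.
  - have ij : i != j by apply: contraTneq bj => <-; rewrite -leNgt.
    apply: mulr_ge0; last exact: ltW.
    by apply: mulr_le0 (cartan_off _ _ _ affA _ _ ij); rewrite bvn.
(* A part of norm zero vanishes if its index set is proper; if it is the whole index set, all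
   coordinates of b have one sign anyway. *)
have [P0|Q0] : NP = 0 \/ NQ = 0 by lia.
- have [/existsP pP|] := boolP [exists j, j \notin P]; last first.
    rewrite negb_exists => /forallP full; left=> j.
    by have := full j; rewrite negbK inE => /ltW.
  right=> j; have [jP|] := boolP (j \in P); last by rewrite inE -leNgt.
  by rewrite (NPz P0).
- have [/existsP [k0 k0P]|] := boolP [exists j, j \in P]; last first.
    rewrite negb_exists => /forallP full; right=> j.
    by have := full j; rewrite inE -leNgt.
  left=> j; have [|jP] := boolP (j \in P); first by rewrite inE => /ltW.
  rewrite (NQz Q0) ?inE //; first by exists k0; rewrite inE negbK.
  by move: jP; rewrite inE.
Qed.

(** A nonzero coordinate of b away from j survives the reflection and stays positive, so
    sign-coherence makes the whole reflected root positive. Without such a coordinate b is a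
    multiple of alpha_j, and integrality of the pairing 2 forces the multiple to be 1. *)
Lemma positive_root_reflect b bv j :
  root_coroot A b bv -> (forall k, 0 <= b k 0) ->
  b = delta_mx j 0 /\ bv = delta_mx j 0 \/
  forall k, 0 <= (b - (A *m b) j 0 *: delta_mx j 0) k 0.
Proof.
move=> rb bpos.
have [/existsP[k /andP[kj bk]]|] := boolP [exists k, (k != j) && (b k 0 != 0)].
  right; have [//|neg] := root_sign _ _ (RootReflect j rb).
  have := neg k; rewrite !mxE andbT (negPf kj) mulr0 subr0 => le0.
  by case/negP: bk; rewrite eq_le le0 bpos.
rewrite negb_exists => /forallP z; left.
have bE : b = b j 0 *: delta_mx j 0.
  apply/colP => k; rewrite !mxE andbT; have := z k; rewrite negb_and !negbK.
  by have [->|_ /eqP ->] := eqVneq k j; rewrite ?mulr1 ?mulr0.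
have [t t0 tE] := root_proportional _ _ _ e0 (cartan_sym _ _ _ affA) rb.
have bvE : bv = bv j 0 *: delta_mx j 0.
  apply/colP => k; rewrite !mxE andbT; have [->|kj] := eqVneq k j.
    by rewrite mulr1.
  rewrite mulr0; apply: (@intr_inj rat); apply: (mulfI (lt0r_neq0 t0)).
  have := z k; rewrite kj /= negbK => /eqP bk.
  by rewrite tE bk !mulr0.
have := root_pairing _ _ A2 rb.
rewrite {1}bE -scalemxAr [LHS]mxE app_delta mulmx_dot_tr {1}bvE -scalemxAr.
rewrite [X in _ * X]mxE -colE [X in _ * (_ * X)]mxE mxE A2.
have := bpos j => b0 b1.
have [b1' bv1] : b j 0 = 1 /\ bv j 0 = 1.
  move: (b j 0) (bv j 0) b0 b1 => x y x0 xy.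
  have {}xy : x * y = 1 by lia.
  have {}x0 : 0 < x.
    by rewrite lt_neqAle x0 andbT; apply: contra_eqN xy => /eqP <-; rewrite mul0r.
  have y0 : 0 < y by rewrite -(pmulr_rgt0 _ x0) xy.
  have x1 : x <= 1 by rewrite -xy ler_peMr // ltW.
  have x1' : x = 1 by lia.
  by rewrite x1' mul1r in xy.
by rewrite bE bvE b1' bv1 !scale1r.
Qed.

(* The coordinates of lambda - w(lambda) on the simple roots, where w is the
   product of the reflections in js and m_i is the pairing of lambda with the
   i-th simple coroot. *)
Definition orbit_coord (m : 'cV[int]_n) (js : seq 'I_n) : 'cV[int]_n :=
  foldr (fun j c => c + (m - A *m c) j 0 *: delta_mx j 0) 0 js.

(** The exchange property: for a positive root b pairing negatively with w lambda, a word shorter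
    than that of w gives s_b w lambda. Strip the letters of w and reflect b along: b stays positive
    until it equals the simple root of the leading letter, and then s_b cancels that letter. On the
    empty word the pairing cannot be negative. *)
Lemma orbit_exchange (m : 'cV[int]_n) b bv js :
  (forall i, 0 <= m i 0) -> root_coroot A b bv -> (forall k, 0 <= b k 0) ->
  (bv^T *m (m - A *m orbit_coord m js)) 0 0 < 0 ->
  exists2 js' : seq 'I_n, (size js' < size js)%N &
    orbit_coord m js + (bv^T *m (m - A *m orbit_coord m js)) 0 0 *: b =
    orbit_coord m js'.
Proof.
move=> m0; elim: js b bv => [|j js IH] b bv rb bpos /=.
  rewrite mulmx0 subr0 ltNge => /negP[]; rewrite mxE; apply: sumr_ge0 => i _.
  rewrite mxE; apply: mulr_ge0 => //.
  have [t t0 tE] := root_proportional _ _ _ e0 (cartan_sym _ _ _ affA) rb.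
  by rewrite -(@ler0z rat) -(pmulr_rge0 _ t0) tE pmulr_rge0 // ler0z.
set c := orbit_coord m js in IH *; set p := m - A *m c.
have pE t : m - A *m (c + t *: delta_mx j 0) = p - t *: col j A.
  by rewrite mulmxDr -scalemxAr -colE opprD addrA.
have ent k l (X Y : 'M[int]_(k, l)) i1 i2 : (X - Y) i1 i2 = X i1 i2 - Y i1 i2.
  by rewrite !mxE.
have entZ k l t (X : 'M[int]_(k, l)) i1 i2 : (t *: X) i1 i2 = t * X i1 i2.
  by rewrite mxE.
rewrite pE.
have bvc : (bv^T *m col j A) 0 0 = (A^T *m bv) j 0.
  by rewrite colE mulmxA app_delta mulmx_dot_tr.
set y := (A^T *m bv) j 0 in bvc; set z := (A *m b) j 0.
set x := (bv^T *m p) 0 0.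
have xE : (bv^T *m (p - p j 0 *: col j A)) 0 0 = x - p j 0 * y.
  by rewrite mulmxBr -scalemxAr ent entZ bvc.
have [[bE bvE]|b'pos] := positive_root_reflect _ _ j rb bpos.
  move=> _; exists js => //; rewrite xE.
  have -> : x = p j 0 by rewrite /x bvE delta_dot.
  have -> : y = 2 by rewrite -bvc bvE delta_dot mxE A2.
  rewrite bE -addrA -scalerDl.
  have -> : p j 0 + (p j 0 - p j 0 * 2) = 0 by ring.
  by rewrite scale0r addr0.
rewrite xE => neg.
set b' := b - z *: delta_mx j 0 in b'pos.
set bv' := bv - y *: delta_mx j 0.
have bvp' : (bv'^T *m p) 0 0 = x - p j 0 * y.
  have -> : bv'^T = bv^T - y *: (delta_mx j 0)^T.
    by rewrite /bv' linearB linearZ.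
  rewrite mulmxBl -scalemxAl ent entZ delta_dot.
  by rewrite mulrC.
(* Since s_b s_j = s_j s_b' for b' = s_j b, the shorter word found for b' and [js] only has to be
   prefixed by j. *)
have [|js' lt_js' js'E] := IH b' bv' (RootReflect j rb) b'pos.
  by rewrite bvp'.
exists (j :: js') => //=; rewrite -js'E bvp'.
set s := x - p j 0 * y.
have Ab' : (A *m b') j 0 = - z.
  rewrite /b' mulmxBr -scalemxAr ent entZ -colE [col j A j 0]mxE A2 -/z.
  by ring.
have -> : (m - A *m (c + s *: b')) j 0 = p j 0 + s * z.
  by rewrite mulmxDr -scalemxAr opprD addrA ent entZ Ab' -/p; ring.
rewrite /b' scalerBr scalerA scalerDl -!addrA; congr (_ + _).
by rewrite addrC [RHS]addrCA [in RHS]addrA; apply/colP => k; rewrite !mxE; ring.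
Qed.

(** Strong induction on the length. If the leading reflection subtracts a nonnegative multiple of
    its simple root, the coordinates only grow; otherwise exchange gives a shorter word for the same
    point. *)
Lemma orbit_coord_ge0 (m : 'cV[int]_n) js :
  (forall i, 0 <= m i 0) -> forall k, 0 <= orbit_coord m js k 0.
Proof.
move=> m0; elim: {js}_.+1 {-2}js (ltnSn (size js)) => // s IH [|i js] /= le_s k.
  by rewrite mxE.
have [pi|pi] := lerP 0 ((m - A *m orbit_coord m js) i 0).
  rewrite mxE addr_ge0 ?IH // mxE mulr_ge0 // mxE.
  by case: (_ && _).
have di : forall k, 0 <= (delta_mx i 0 : 'cV[int]_n) k 0.
  by move=> ?; rewrite mxE; case: (_ && _).
have [|js' lt_js'] := orbit_exchange m _ _ js m0 (RootSimple A i) di.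
  by rewrite delta_dot.
rewrite delta_dot => js'E.
by rewrite js'E; apply: IH; lia.
Qed.

Lemma orbit_coord_supported (H : {set 'I_n}) (m : 'cV[int]_n) js :
  all (fun j => j \in H) js -> supported H (fun k => orbit_coord m js k 0).
Proof.
elim: js => [_|j js IH /= /andP[jH jsH]] k kH /=; first by rewrite mxE.
rewrite mxE IH // add0r mxE [X in _ * X]mxE andbT (_ : k == j = false) ?mulr0 //.
by apply: contraNF kH => /eqP ->.
Qed.

(** The vector [delta_mx i 0] stands for Lambda_i. For i in H let g be supported on H with Lambda_i
    - g fixed by W_H. If c are the coordinates of Lambda_i - w Lambda_i, then g - c = w g has the
    norm of g, and [supported_bound] applies. For i outside H, W_H fixes Lambda_i. *)
Lemma orbit_coord_bound (H : {set 'I_n}) (i k : 'I_n) :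
  (exists j, j \notin H) ->
  exists B : rat, forall js, all (fun j => j \in H) js ->
    `|(orbit_coord (delta_mx i 0) js k 0)%:~R| <= B.
Proof.
move=> pH; set S := symform A e.
have [iH|iH] := boolP (i \in H); last first.
  exists 0 => js jsH; suff -> : orbit_coord (delta_mx i 0) js = 0.
    by rewrite mxE normr0.
  elim: js jsH => //= j js IH /andP[jH jsH].
  rewrite IH // mulmx0 subr0 mxE andbT (_ : j == i = false) ?scale0r ?addr0 //.
  by apply: contraNF iH => /eqP <-.
have [g gH gE] := mxapp_solve _ _ _ affS H (fun j => e j * (j == i)%:R) pH.
have [B Bbound] := supported_bound _ _ _ affS H k pH.
exists (`|g k| + (mxform S g g + B)) => js jsH.
pose c js (j : 'I_n) : rat := (orbit_coord (delta_mx i 0) js j 0)%:~R.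
pose x js (j : 'I_n) : rat := g j - c js j.
have xH s : all (fun j => j \in H) s -> supported H (x s).
  move=> sH j jH; rewrite /x /c gH //.
  by rewrite (orbit_coord_supported H (delta_mx i 0) _ sH) // subrr.
have norm_x : mxform S (x js) (x js) = mxform S g g.
  elim: js jsH => [_|j js IH /= /andP[jH jsH]].
    rewrite /x /c /=; congr mxform; apply: funext => ?; rewrite mxE subr0 //.
  rewrite -IH //.
  pose t : rat := ((delta_mx i 0 - A *m orbit_coord (delta_mx i 0) js) j 0)%:~R.
  have -> : x (j :: js) = fun l => x js l + (- t) * (l == j)%:R.
    apply: funext => l; rewrite /x /c /t /=.
    move: (_ j 0) => q; rewrite mxE mxE mxE andbT rmorphD rmorphM /=.
    by case: (l == j); rewrite /= ?mulr1 ?mulr0; ring.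
  have Sx : mxapp S (x js) j = e j * t.
    have -> : x js = fun l => g l + (-1) * c js l.
      by apply: funext => l; rewrite /x; ring.
    rewrite mxappDZ gE // mxapp_symform /t mulN1r -mulrBr; congr (_ * _).
    rewrite !mxE andbT rmorphB rmorph_sum /=.
    by case: (j == i); congr (_ - _); apply: eq_bigr => l _; rewrite intrM.
  rewrite (mxform_quad _ _ _ affS) (mxformC _ _ _ affS) !mxform_deltal mxapp_delta.
  by rewrite Sx mxE A2; ring.
have := Bbound _ (xH _ jsH); rewrite norm_x => le_x.
have -> : (orbit_coord (delta_mx i 0) js k 0)%:~R = g k - x js k :> rat.
  by rewrite /x /c; ring.
by apply: le_trans (ler_normB _ _) _; rewrite lerD2l.
Qed.

End Roots.

(** * The untwisted affine matrix as an affine Cartan matrix *)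

Definition extend0 {l : nat} {T : Type} (t : T) (x : 'I_l -> T)
    (i : 'I_(1 + l)) : T :=
  if fintype.split i is inr k then x k else t.

Lemma extend00 {l : nat} {T : Type} (t : T) (x : 'I_l -> T) :
  extend0 t x (lshift l 0) = t.
Proof. by rewrite /extend0 -/(unsplit (inl 0)) unsplitK. Qed.

Lemma extend0r {l : nat} {T : Type} (t : T) (x : 'I_l -> T) i :
  extend0 t x (rshift 1 i) = x i.
Proof. by rewrite /extend0 -/(unsplit (inr i)) unsplitK. Qed.

Section Untwisted.
Variables (l : nat) (Afin : 'M[int]_l) (theta thetav : 'cV[int]_l).
Hypothesis (hA : simple_cartan_matrix Afin).
Hypothesis (htheta : highest_root Afin theta thetav).
Let A := untwisted_affine_matrix Afin theta thetav.

Lemma untwisted00 : A (lshift l 0) (lshift l 0) = 2.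
Proof. by rewrite /A /untwisted_affine_matrix block_mxEul mxE. Qed.

Lemma untwisted0r j : A (lshift l 0) (rshift 1 j) = - (thetav^T *m Afin) 0 j.
Proof. by rewrite /A /untwisted_affine_matrix block_mxEur mxE. Qed.

Lemma untwistedr0 i : A (rshift 1 i) (lshift l 0) = - (Afin *m theta) i 0.
Proof. by rewrite /A /untwisted_affine_matrix block_mxEdl mxE. Qed.

Lemma untwistedrr i j : A (rshift 1 i) (rshift 1 j) = Afin i j.
Proof. by rewrite /A /untwisted_affine_matrix block_mxEdr. Qed.

Lemma cartan_diag_fin i : Afin i i = 2.
Proof. by case: hA => -[]. Qed.

(** Compare theta with the simple root alpha_i. *)
Lemma highest_root_ge1 i : 1 <= theta i 0.
Proof.
have := htheta.2 _ _ (RootSimple Afin i) i; rewrite mxE !eqxx; exact.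
Qed.

(** The root s_i theta cannot exceed theta in its i-th coordinate. *)
Lemma highest_root_dominant i : 0 <= (Afin *m theta) i 0.
Proof.
have := htheta.2 _ _ (RootReflect i htheta.1) i.
move: ((Afin *m theta) i 0) => z; rewrite !mxE !eqxx.
by rewrite mulr1 gerDl oppr_le0.
Qed.

Lemma highest_root_pairing : (thetav^T *m Afin *m theta) 0 0 = 2.
Proof. exact: root_pairing cartan_diag_fin htheta.1. Qed.

Lemma highest_coroot_gt0 i : 0 < thetav i 0.
Proof.
have [_ _ [e [e0 eA _]]] := hA.
have [t t0 tE] := root_proportional _ _ _ _ _ e0 eA htheta.1.
rewrite -(@ltr0z rat) -(pmulr_rgt0 _ t0) tE pmulr_rgt0 // ltr0z.
exact: lt_le_trans (highest_root_ge1 i).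
Qed.

(** The Kac labels, that is, the coordinates of delta = alpha_0 + theta on the simple roots. *)
Definition affine_marks : 'I_(1 + l) -> rat :=
  extend0 1 (fun i => (theta i 0)%:~R).

Lemma affine_marks0 : affine_marks (lshift l 0) = 1.
Proof. exact: extend00. Qed.

Lemma affine_marksr i : affine_marks (rshift 1 i) = (theta i 0)%:~R.
Proof. exact: extend0r. Qed.

Lemma untwisted_affine_cartan : exists e, affine_cartan A e affine_marks.
Proof.
have [[_ Aoff _] [l0 Aind] [e [e0 eA _]]] := hA.
have [t t0 tE] := root_proportional _ _ _ _ _ e0 eA htheta.1.
have tA i := proportional_app _ _ _ _ _ _ i eA tE.
have dv j : 0 <= (thetav^T *m Afin) 0 j.
  rewrite mulmx_dot_tr -(@ler0z rat) -(pmulr_rge0 _ t0) tA.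
  by rewrite pmulr_rge0 // ler0z highest_root_dominant.
(* Node 0 gets the factor t with t theta^vee = e theta, which matches row 0 with column 0. *)
exists (extend0 t e).
split.
- move=> i; case: (split_ordP i) => k ->; rewrite ?ord1 ?untwisted00 //.
  by rewrite untwistedrr cartan_diag_fin.
- move=> i j; case: (split_ordP i) => k ->; case: (split_ordP j) => m ->;
    rewrite ?(ord1 k) ?(ord1 m) ?eqxx // ?untwisted0r ?untwistedr0 ?untwistedrr.
  + by rewrite oppr_le0.
  + by rewrite oppr_le0 highest_root_dominant.
  + by rewrite eq_rshift; apply: Aoff.
- by move=> i; rewrite /extend0; case: fintype.split.
- move=> i j; case: (split_ordP i) => k ->; case: (split_ordP j) => m ->;
    rewrite ?(ord1 k) ?(ord1 m) ?extend00 ?extend0r ?untwisted0r ?untwistedr0 ?untwistedrr //.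
  + by rewrite !rmorphN /= !mulrN mulmx_dot_tr tA.
  + by rewrite !rmorphN /= !mulrN mulmx_dot_tr tA.
- move=> i; case: (split_ordP i) => k ->; first by rewrite ord1 affine_marks0.
  by rewrite affine_marksr ltr0z; apply: lt_le_trans (highest_root_ge1 k).
- move=> i; rewrite big_split_ord /= big_ord1 affine_marks0.
  under eq_bigr do rewrite affine_marksr.
  case: (split_ordP i) => k ->.
  + rewrite ord1 untwisted00; under eq_bigr do rewrite untwisted0r.
    have := highest_root_pairing; rewrite mxE => E.
    rewrite mulr1 -[X in X%:~R + _]E rmorph_sum -big_split big1 //= => j _.
    by rewrite intrM rmorphN /=; ring.
  + under eq_bigr do rewrite untwistedrr.
    rewrite untwistedr0 mxE mulr1 rmorphN rmorph_sum -sumrN -big_split big1 //=.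
    by move=> j _; rewrite intrM; ring.
(* If J splits the finite nodes, indecomposability of [Afin] gives the edge. Otherwise J separates
   node 0 from all finite nodes, and the nonzero pairing of theta^vee with theta yields an edge at
   0. *)
- move=> J [i0 i0J] [j0 j0J].
  have [/existsP[i iJ]|] := boolP [exists i, rshift 1 i \in J]; last first.
    rewrite negb_exists => /forallP J0.
    have J00 : lshift l 0 \in J.
      move: i0J; case: (split_ordP i0) => k ->; first by rewrite ord1.
      by rewrite (negPf (J0 k)).
    have [/existsP[j Aj]|] := boolP [exists j, (thetav^T *m Afin) 0 j != 0].
      by exists (lshift l 0), (rshift 1 j); rewrite untwisted0r oppr_eq0.
    rewrite negb_exists => /forallP A0; have := highest_root_pairing.
    by rewrite mxE big1 // => k _; have := A0 k; rewrite negbK => /eqP ->; rewrite mul0r.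
  have [/existsP[j jJ]|] := boolP [exists j, rshift 1 j \notin J]; last first.
    rewrite negb_exists => /forallP J1.
    have J00 : lshift l 0 \notin J.
      move: j0J; case: (split_ordP j0) => k ->; first by rewrite ord1.
      by rewrite (negPf (J1 k)).
    have [/existsP[k Ak]|] := boolP [exists k, (Afin *m theta) k 0 != 0].
      exists (rshift 1 k), (lshift l 0); rewrite untwistedr0 oppr_eq0; split => //.
      by have := J1 k; rewrite negbK.
    rewrite negb_exists => /forallP A0; have := highest_root_pairing.
    rewrite -mulmxA mxE big1 // => k _.
    by have := A0 k; rewrite negbK => /eqP ->; rewrite mulr0.
  have [||i1 [j1 [i1J j1J A1]]] := Aind [set i | rshift 1 i \in J]%SET.
  + by exists i; rewrite inE.
  + by exists j; rewrite inE.
  by exists (rshift 1 i1), (rshift 1 j1); rewrite untwistedrr; move: i1J j1J; rewrite !inE.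
Qed.

(** Positive definiteness makes the finite block invertible over Q, hence over C because its
    determinant is an integer, and a block has at most the rank of the matrix. *)
Lemma untwisted_rank (C : numFieldType) :
  (l <= \rank (map_mx (intr : int -> C) A))%N.
Proof.
pose F : 'M[rat]_l := map_mx intr Afin.
have uF : F \in unitmx.
  have [_ _ [e [e0 eA pd]]] := hA.
  rewrite -unitmx_tr -row_free_unit -kermx_eq0; apply/eqP/row_matrixP => i.
  rewrite row0; set v := row i _.
  have Fv : F *m v^T = 0.
    by rewrite -[F]trmxK -trmx_mul /v -row_mul mulmx_ker row0 trmx0.
  apply/rowP => k; rewrite [RHS]mxE; apply/eqP/negPn/negP => vk.
  have := pd (v 0) (ex_intro _ k vk); rewrite big1 ?ltxx // => j _.
  transitivity (v 0 j * e j * (F *m v^T) j 0); last by rewrite Fv [X in _ * X]mxE mulr0.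
  rewrite [X in _ * X]mxE mulr_sumr; apply: eq_bigr => m _; rewrite [F _ _]mxE [v^T _ _]mxE.
  by ring.
have dF : \det Afin != 0.
  by move: uF; rewrite unitmxE /F det_map_mx unitfE intr_eq0.
have uC : map_mx (intr : int -> C) Afin \in unitmx.
  by rewrite unitmxE det_map_mx unitfE intr_eq0.
rewrite -[X in (X <= _)%N](mxrank_unit uC).
have -> : map_mx (intr : int -> C) Afin =
    row_mx 0 1%:M *m map_mx (intr : int -> C) A *m col_mx 0 1%:M.
  rewrite /A /untwisted_affine_matrix map_block_mx mul_row_block mul_row_col.
  by rewrite !mul0mx !mulmx0 !mul1mx !mulmx1 !add0r.
by apply: leq_trans (mxrankM_maxl _ _) _; apply: mxrankM_maxr.
Qed.

(** Padding by 0 at node 0 commutes with the reflections of the finite nodes. Applied to theta, this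
    places s_theta in the affine Weyl group. *)
Lemma root_coroot_untwisted b bv : root_coroot Afin b bv ->
  root_coroot A (col_mx 0 b) (col_mx 0 bv).
Proof.
have dE i : delta_mx (rshift 1 i) 0 = col_mx 0 (delta_mx i 0) :> 'cV[int]_(1 + l).
  apply/colP => k; case: (split_ordP k) => m ->.
    by rewrite col_mxEu !mxE eq_lrshift.
  by rewrite col_mxEd !mxE eq_rshift.
elim=> {b bv} [i|i b bv _ IH]; first by rewrite -dE; apply: RootSimple.
have := RootReflect (rshift 1 i) IH.
rewrite dE !scale_col_mx !scaler0 !opp_col_mx !add_col_mx !subr0.
rewrite {1 2}/A /untwisted_affine_matrix tr_block_mx !mul_block_col.
by rewrite !mulmx0 !add0r !col_mxEd.
Qed.

End Untwisted.

(** * The Weyl group action on weights *)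

Section Weights.
Variables (C : numFieldType) (n : nat) (A : 'M[int]_n) (g : kac_moody C A).
Implicit Types mu lambda : dual_cartan g.

Lemma pairingD mu nu x : pairing (mu + nu : dual_cartan g) x = pairing mu x + pairing nu x.
Proof. by rewrite /pairing add_lfunE. Qed.

Lemma pairingB mu nu x : pairing (mu - nu : dual_cartan g) x = pairing mu x - pairing nu x.
Proof. by rewrite pairingD /pairing opp_lfunE. Qed.

Lemma pairingZ t mu x : pairing (t *: mu : dual_cartan g) x = t * pairing mu x.
Proof. by rewrite /pairing scale_lfunE. Qed.

Lemma pairing_sum (I : Type) (r : seq I) (F : I -> dual_cartan g) x :
  pairing (\sum_(i <- r) F i) x = \sum_(i <- r) pairing (F i) x.
Proof. by rewrite /pairing sum_lfunE. Qed.

Definition root_comb (c : 'I_n -> C) : dual_cartan g :=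
  \sum_j c j *: km_root g j.

Lemma root_combD c c' :
  root_comb (fun j => c j + c' j) = root_comb c + root_comb c'.
Proof. by rewrite -big_split; apply: eq_bigr => j _; rewrite scalerDl. Qed.

Lemma root_combZ t c : root_comb (fun j => t * c j) = t *: root_comb c.
Proof. by rewrite scaler_sumr; apply: eq_bigr => j _; rewrite scalerA. Qed.

Lemma root_comb_sum (I : Type) (r : seq I) (F : I -> 'I_n -> C) :
  root_comb (fun j => \sum_(i <- r) F i j) = \sum_(i <- r) root_comb (F i).
Proof.
by rewrite exchange_big; apply: eq_bigr => j _; rewrite scaler_suml.
Qed.

Lemma root_comb_delta k : root_comb (fun j => (j == k)%:R) = km_root g k.
Proof.
rewrite /root_comb (bigD1 k) //= eqxx scale1r big1 ?addr0 // => j /negPf ->.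
by rewrite scale0r.
Qed.

Lemma eq_root_comb c c' : c =1 c' -> root_comb c = root_comb c'.
Proof. by move=> cc; apply: eq_bigr => j _; rewrite cc. Qed.

Lemma pairing_root_comb c i :
  pairing (root_comb c) (km_coroot g i) = \sum_j (A i j)%:~R * c j.
Proof.
rewrite pairing_sum; apply: eq_bigr => j _.
by rewrite pairingZ /pairing km_pairing mulrC.
Qed.

Lemma pairing_root_comb_rat (c : 'I_n -> rat) i :
  pairing (root_comb (fun j => ratr (c j))) (km_coroot g i) =
  ratr (\sum_j (A i j)%:~R * c j).
Proof.
rewrite pairing_root_comb rmorph_sum; apply: eq_bigr => j _.
by rewrite rmorphM /= ratr_int.
Qed.

Lemma pairing_root_comb_int (c : 'cV[int]_n) i :
  pairing (root_comb (fun j => (c j 0)%:~R)) (km_coroot g i) =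
  ((A *m c) i 0)%:~R.
Proof.
rewrite pairing_root_comb mxE rmorph_sum; apply: eq_bigr => j _.
by rewrite -intrM.
Qed.

Lemma reflectionE i mu :
  reflection g i mu = mu - pairing mu (km_coroot g i) *: km_root g i.
Proof. by rewrite lfunE. Qed.

Lemma weyl_word_cons j js mu :
  weyl_word g (j :: js) mu = reflection g j (weyl_word g js mu).
Proof. by rewrite /= comp_lfunE. Qed.

Lemma weyl_word_cat js js' mu :
  weyl_word g (js ++ js') mu = weyl_word g js (weyl_word g js' mu).
Proof.
elim: js => [|j js IH]; first by rewrite id_lfunE.
by rewrite cat_cons !weyl_word_cons IH.
Qed.

Lemma weyl_word_fixed js mu :
  (forall i, pairing mu (km_coroot g i) = 0) -> weyl_word g js mu = mu.
Proof.
move=> mu0; elim: js => [|j js IH]; first by rewrite id_lfunE.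
by rewrite weyl_word_cons IH reflectionE mu0 scale0r subr0.
Qed.

Lemma weyl_orbit_word lambda js : weyl_orbit lambda (weyl_word g js lambda).
Proof.
by exists (weyl_word g js) => //; exists js => //; apply/allP => j _; rewrite inE.
Qed.

Lemma root_comb_delta_shift (c : 'cV[int]_n) (t : int) k :
  root_comb (fun j => ((c + t *: delta_mx k 0) j 0)%:~R) =
  root_comb (fun j => (c j 0)%:~R) + t%:~R *: km_root g k.
Proof.
rewrite -(root_comb_delta k) -root_combZ -root_combD; apply: eq_root_comb => j.
rewrite mxE [X in _ + X]mxE [X in _ * X]mxE andbT rmorphD rmorphM /=.
by case: (j == k).
Qed.

Lemma weyl_word_orbit_coord (m : 'cV[int]_n) lambda js :
  (forall i, pairing lambda (km_coroot g i) = (m i 0)%:~R) ->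
  weyl_word g js lambda =
  lambda - root_comb (fun j => (orbit_coord n A m js j 0)%:~R).
Proof.
move=> mE; elim: js => [|j js IH].
  rewrite id_lfunE /root_comb big1 ?subr0 // => j _.
  by rewrite mxE scale0r.
rewrite weyl_word_cons IH reflectionE pairingB mE pairing_root_comb_int.
have -> : (m j 0)%:~R - ((A *m orbit_coord n A m js) j 0)%:~R =
    ((m - A *m orbit_coord n A m js) j 0)%:~R :> C.
  by rewrite -rmorphB !mxE.
have -> := root_comb_delta_shift (orbit_coord n A m js)
  ((m - A *m orbit_coord n A m js) j 0) j.
by rewrite opprD addrA.
Qed.

(** The case of arbitrary mu follows by linearity from that of the Lambda_i, represented by
    [delta_mx i 0]. It shows that a Weyl group element is determined by an integer matrix. *)
Lemma weyl_word_coord mu js :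
  weyl_word g js mu = mu - \sum_i pairing mu (km_coroot g i) *:
    root_comb (fun j => (orbit_coord n A (delta_mx i 0) js j 0)%:~R).
Proof.
elim: js => [|j js IH].
  rewrite id_lfunE big1 ?subr0 // => i _.
  by rewrite /root_comb big1 ?scaler0 // => j _; rewrite mxE scale0r.
rewrite weyl_word_cons reflectionE IH -addrA -opprD; congr (_ - _).
under [RHS]eq_bigr do rewrite /= root_comb_delta_shift scalerDr scalerA.
rewrite big_split /= -scaler_suml; congr (_ + _ *: _).
rewrite pairingB pairing_sum.
have -> : pairing mu (km_coroot g j) =
    \sum_i pairing mu (km_coroot g i) * (j == i)%:R.
  rewrite (bigD1 j) //= eqxx mulr1 big1 ?addr0 // => i.
  by rewrite eq_sym => /negPf ->; rewrite mulr0.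
rewrite -sumrB; apply: eq_bigr => i _.
rewrite pairingZ pairing_root_comb_int -mulrBr; congr (_ * _).
have -> : (delta_mx i 0 - A *m orbit_coord n A (delta_mx i 0) js) j 0 =
    (j == i)%:R - (A *m orbit_coord n A (delta_mx i 0) js) j 0.
  by rewrite !mxE andbT.
by rewrite rmorphB /=; case: (j == i).
Qed.

(** The reflection in s_i b is the conjugate s_i s_b s_i, so each step adds i at both ends of the
    word. *)
Lemma reflection_word b bv :
  (forall i, A i i = 2) -> root_coroot A b bv ->
  exists js, forall mu, weyl_word g js mu = mu -
    (\sum_i (bv i 0)%:~R * pairing mu (km_coroot g i)) *:
      root_comb (fun j => (b j 0)%:~R).
Proof.
move=> A2; elim=> {b bv} [i|i b bv _ [js IH]].
  exists [:: i] => mu; rewrite weyl_word_cons id_lfunE reflectionE.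
  congr (_ - _ *: _).
    rewrite (bigD1 i) //= mxE !eqxx mul1r big1 ?addr0 // => j /negPf ji.
    by rewrite mxE ji mul0r.
  rewrite -root_comb_delta; apply: eq_root_comb => j.
  by rewrite mxE andbT; case: (j == i).
exists (i :: js ++ [:: i]) => mu.
rewrite weyl_word_cons weyl_word_cat [weyl_word g [:: i] mu]weyl_word_cons id_lfunE.
rewrite IH (reflectionE i mu); set q := pairing mu (km_coroot g i).
set B := root_comb (fun j => (b j 0)%:~R).
set phi := \sum_k (bv k 0)%:~R * pairing mu (km_coroot g k).
have -> : \sum_k (bv k 0)%:~R * pairing (mu - q *: km_root g i) (km_coroot g k) =
    phi - ((A^T *m bv) i 0)%:~R * q.
  rewrite mxE rmorph_sum mulr_suml -sumrB; apply: eq_bigr => k _ /=.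
  rewrite pairingB pairingZ mxE intrM /pairing km_pairing -/(pairing mu _).
  by ring.
have -> : root_comb (fun j =>
    ((b - (A *m b) i 0 *: delta_mx i 0) j 0)%:~R) =
    B - ((A *m b) i 0)%:~R *: km_root g i.
  by rewrite -scaleNr root_comb_delta_shift rmorphN scaleNr.
have -> : \sum_k ((bv - (A^T *m bv) i 0 *: delta_mx i 0) k 0)%:~R *
    pairing mu (km_coroot g k) = phi - ((A^T *m bv) i 0)%:~R * q.
  rewrite /phi; move: ((A^T *m bv) i 0) => y.
  have -> : y%:~R * q = \sum_k y%:~R * (k == i)%:R * pairing mu (km_coroot g k).
    rewrite (bigD1 i) //= eqxx mulr1 big1 ?addr0 // => k /negPf ->.
    by rewrite mulr0 mul0r.
  rewrite -sumrB; apply: eq_bigr => k _; rewrite -mulrBl; congr (_ * _).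
  by rewrite !mxE andbT rmorphB rmorphM /=; case: (k == i).
move: (phi - _) => s; set z := (A *m b) i 0.
have Bi : pairing B (km_coroot g i) = z%:~R by rewrite pairing_root_comb_int.
have ri : pairing (km_root g i) (km_coroot g i) = 2 by rewrite /pairing km_pairing A2.
rewrite reflectionE !pairingB !pairingZ ri Bi -/q.
have -> : q - q * 2 - s * z%:~R = - (q + s * z%:~R) by ring.
rewrite scaleNr opprK scalerDl scalerBr scalerA opprB.
by rewrite [_ - _ - _ *: B]addrAC addrA subrK [RHS]addrA [RHS]addrAC.
Qed.

Variables (e a : 'I_n -> rat).
Hypothesis affA : affine_cartan A e a.

Lemma reflectionK i mu : reflection g i (reflection g i mu) = mu.
Proof.
rewrite !reflectionE pairingB pairingZ.
have -> : pairing (km_root g i) (km_coroot g i) = 2.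
  by rewrite /pairing km_pairing (cartan_diag _ _ _ affA).
set q := pairing _ _; have -> : q - q * 2 = - q by ring.
by rewrite scaleNr opprK subrK.
Qed.

End Weights.

(** * Finiteness of W_H and the averages over it *)

Section Parabolic.
Variables (C : numFieldType) (n : nat) (A : 'M[int]_n) (g : kac_moody C A).
Variables (e a : 'I_n -> rat).
Hypothesis affA : affine_cartan A e a.
Variable H : {set 'I_n}.
Hypothesis pH : exists j, j \notin H.

(* An element of W_H is determined by the coordinates of the vectors
   Lambda_i - w(Lambda_i), which are integers bounded by [orbit_coord_bound]. *)
Lemma parabolic_finite : finite_set (parabolic (g := g) H).
Proof.
have /choice[B1 B1P] : forall ik : 'I_n * 'I_n, exists B : rat,
    forall js, all (fun j => j \in H) js ->
    `|(orbit_coord n A (delta_mx ik.1 0) js ik.2 0)%:~R| <= B.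
  by case=> i k; apply: orbit_coord_bound affA _ _ _ pH.
(* Each [B1 ik] is nonnegative, since it bounds an absolute value at the empty word; hence their sum
   bounds every coordinate. *)
pose N := (Num.Def.archi_bound (\sum_ik B1 ik)).
have NP js i k : all (fun j => j \in H) js ->
    (absz (orbit_coord n A (delta_mx i 0%R) js k 0%R) < N.+1)%N.
  move=> jsH; rewrite ltnS; apply: ltnW.
  rewrite -(@ltr_nat rat); apply: le_lt_trans (archi_boundP _); last first.
    by apply: sumr_ge0 => ik _; apply: le_trans (B1P ik [::] _).
  rewrite natr_absz intr_norm; apply: le_trans (B1P (i, k) _ jsH) _.
  rewrite (bigD1 (i, k)) //= lerDl; apply: sumr_ge0 => ik _.
  exact: le_trans (B1P ik [::] _).
(* A code stores the sign and the absolute value of every matrix entry. At most one w satisfies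
   [rel F], so [xget] recovers w from its code. *)
pose code := {ffun 'I_n * 'I_n -> bool * 'I_N.+1}.
pose dec (F : code) i k : int := (-1) ^+ (F (i, k)).1 * (F (i, k)).2%:Z.
pose rel (F : code) : set 'End(dual_cartan g) := fun w =>
  forall mu, w mu = mu - \sum_i pairing mu (km_coroot g i) *:
    root_comb C n A g (fun j => (dec F i j)%:~R).
apply: (@sub_finite_set _ _ [set xget 0 (rel F) | F in [set: code]]); last first.
  exact: finite_image finite_finset.
move=> w [js jsH ->].
pose F : code := [ffun ik => (orbit_coord n A (delta_mx ik.1 0) js ik.2 0 < 0,
  inord (absz (orbit_coord n A (delta_mx ik.1 0) js ik.2 0)))].
have Fw : rel F (weyl_word g js).
  move=> mu; rewrite weyl_word_coord; congr (_ - _); apply: eq_bigr => i _.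
  congr (_ *: _); apply: eq_root_comb => k; congr (_%:~R).
  by rewrite /dec ffunE /= inordK ?NP // -intEsign.
exists F => //; have := xgetPex 0 (ex_intro _ _ Fw) => FE.
by apply/lfunP => mu; rewrite FE Fw.
Qed.

(** Each w in W_H moves lambda by a combination of the alpha_j with j in H, and so does the average.
    Left multiplication by s_j permutes W_H, so s_j fixes the average, which therefore pairs to 0
    with alpha_j^vee. *)
Lemma bhat_coord (m : 'cV[int]_n) (lambda : dual_cartan g) :
  (forall i, pairing lambda (km_coroot g i) = (m i 0)%:~R) ->
  exists c : 'I_n -> rat,
    [/\ supported H c,
        bhat H lambda = lambda - root_comb C n A g (fun j => ratr (c j)),
        forall j, j \in H -> pairing (bhat H lambda) (km_coroot g j) = 0
      & conv_rat (weyl_orbit lambda) (bhat H lambda)].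
Proof.
move=> mE; have finW := parabolic_finite.
set S := fset_set (parabolic (g := g) H).
(* Since W_H is finite, [fset_set] lists exactly its elements. *)
have SP w : (w \in S) = `[< parabolic H w >] by rewrite in_fset_set.
have /choice[f fP] : forall w : 'End(dual_cartan g), exists c : 'cV[int]_n,
    w \in S -> supported H (fun k => c k 0) /\
    w lambda = lambda - root_comb C n A g (fun j => (c j 0)%:~R).
  move=> w; have [|_] := boolP (w \in S); last by exists 0.
  rewrite SP => /asboolP[js jsH ->]; exists (orbit_coord n A m js) => _.
  split; first exact: orbit_coord_supported.
  exact: weyl_word_orbit_coord.
have S1 : \1%VF \in S by rewrite SP; apply/asboolP; exists [::].
have N0 : (size S)%:R != 0 :> rat.
  by rewrite pnatr_eq0 size_eq0; apply: contraTneq S1 => S0; rewrite -[_ \in S]/(_ \in enum_fset S) S0.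
have N0C : (size S)%:R != 0 :> C.
  by move: N0; rewrite !pnatr_eq0.
have bE : bhat H lambda = (size S)%:R^-1 *: \sum_(w <- S) w lambda by [].
exists (fun j => (size S)%:R^-1 * \sum_(w <- S) (f w j 0)%:~R); split.
- move=> j jH; rewrite big_seq big1 ?mulr0 // => w /fP[wH _].
  by rewrite (wH j jH).
- rewrite bE big_seq.
  under eq_bigr => w /fP[_ ->] do [].
  rewrite -big_seq sumrB big_const_seq count_predT iter_addr_0 -scaler_nat.
  rewrite scalerBr scalerA mulVf // scale1r; congr (_ - _).
  rewrite -root_comb_sum -root_combZ; apply: eq_root_comb => j.
  rewrite rmorphM fmorphV /= ratr_nat rmorph_sum; congr (_ * _).
  by apply: eq_bigr => w _ /=; rewrite ratr_int.
- move=> j jH.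
  have inv : reflection g j (bhat H lambda) = bhat H lambda.
    rewrite bE linearZ linear_sum /=; congr (_ *: _).
    pose sj (w : 'End(dual_cartan g)) := (reflection g j \o w)%VF.
    have sjK : involutive sj.
      by move=> w; apply/lfunP => mu; rewrite !comp_lfunE (reflectionK _ _ _ _ _ _ affA).
    have sjS w : w \in S -> sj w \in S.
      rewrite !SP => /asboolP[js jsH ->]; apply/asboolP.
      by exists (j :: js) => //=; rewrite jH.
    transitivity (\sum_(w <- map sj S) w lambda).
      by rewrite big_map; apply: eq_bigr => w _; rewrite comp_lfunE.
    apply: perm_big; apply: uniq_perm => [||w].
    + by rewrite map_inj_uniq ?fset_uniq //; apply: inv_inj.
    + exact: fset_uniq.
    + apply/mapP/idP => [[v vS ->]|wS]; first exact: sjS.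
      by exists (sj w); [exact: sjS|rewrite sjK].
  move: (bhat H lambda) inv => nu inv.
  have := congr1 (fun mu => pairing mu (km_coroot g j)) inv.
  rewrite /= reflectionE pairingB pairingZ.
  have -> : pairing (km_root g j) (km_coroot g j) = 2.
    by rewrite /pairing km_pairing (cartan_diag _ _ _ affA).
  set q := pairing _ _ => qE.
  have : q * 2 = q - (q - q * 2) by ring.
  rewrite qE subrr.
  by move/eqP; rewrite mulf_eq0 pnatr_eq0 orbF => /eqP.
- exists (size S), (fun=> (size S)%:R^-1), (fun k => (nth 0 S k : 'End(dual_cartan g)) lambda).
  split.
  + by move=> k; rewrite invr_ge0.
  + by rewrite sumr_const card_ord -[X in X *+ _]mul1r -mulrnAr -mulr_natr mul1r mulVf.
  + move=> k; have : nth 0 S k \in S by apply: mem_nth.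
    by rewrite SP => /asboolP[js _ ->]; apply: weyl_orbit_word.
  + rewrite bE scaler_sumr (big_nth 0) big_mkord.
    by apply: eq_bigr => k _; rewrite fmorphV /= ratr_nat.
Qed.

End Parabolic.

(** * Rational weights and the inequalities of the dominant polyhedron *)

Section DominantPolyhedron.
Variables (C : numFieldType) (l : nat) (Afin : 'M[int]_l).
Variables (theta thetav : 'cV[int]_l).
Hypothesis (hA : simple_cartan_matrix Afin).
Hypothesis (htheta : highest_root Afin theta thetav).
Let A := untwisted_affine_matrix Afin theta thetav.
Variables (g : kac_moody C A) (d : km_cartan g).
Hypothesis hd : is_derivation_element d.
Let delta := basic_imaginary_root g.
Let marks := affine_marks l theta.
Let rcomb (c : 'I_(1 + l) -> rat) := root_comb C (1 + l) A g (fun j => ratr (c j)).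

Lemma imaginary_root_comb : delta = rcomb marks.
Proof.
rewrite /rcomb /root_comb /marks big_split_ord /= big_ord1 affine_marks0 rmorph1 scale1r.
by congr (_ + _); apply: eq_bigr => i _; rewrite affine_marksr ratr_int.
Qed.

Lemma pairing_imaginary_root i : pairing delta (km_coroot g i) = 0.
Proof.
have [e affA] := untwisted_affine_cartan _ _ _ _ hA htheta.
by rewrite imaginary_root_comb pairing_root_comb_rat (cartan_null _ _ _ affA) rmorph0.
Qed.

Lemma pairing_root_comb_derivation (c : 'I_(1 + l) -> C) :
  pairing (root_comb C (1 + l) A g c) d = c (lshift l 0).
Proof.
rewrite pairing_sum (bigD1 (lshift l 0)) //= pairingZ hd eqxx mulr1.
by rewrite big1 ?addr0 // => j /negPf j0; rewrite pairingZ hd j0 mulr0.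
Qed.

Lemma pairing_imaginary_derivation : pairing delta d = 1.
Proof.
by rewrite imaginary_root_comb pairing_root_comb_derivation /marks affine_marks0 rmorph1.
Qed.

(* The coroots and d form a basis of the Cartan subalgebra, which has dimension
   l + 2 because the affine matrix has corank at most 1. *)
Lemma weight_eq0 (mu : dual_cartan g) :
  (forall i, pairing mu (km_coroot g i) = 0) -> pairing mu d = 0 -> mu = 0.
Proof.
move=> mu0 mud.
pose X := [seq km_coroot g i | i <- enum 'I_(1 + l)].
have kerX (nu : dual_cartan g) : (forall i, pairing nu (km_coroot g i) = 0) ->
    (<<X>> <= lker nu)%VS.
  move=> nu0; apply/span_subvP => x /mapP[i _ ->].
  by rewrite memv_ker; apply/eqP; exact: nu0.
have frX : free (d :: X).
  rewrite free_cons km_coroot_free andbT; apply/negP => dX.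
  have := subvP (kerX _ pairing_imaginary_root) d dX.
  rewrite memv_ker => /eqP d0.
  by have := pairing_imaginary_derivation; rewrite /pairing d0 => /eqP; rewrite eq_sym oner_eq0.
have full : (<<d :: X>> = fullv)%VS.
  apply/eqP; rewrite eqEdim subvf /= (eqnP frX) /= size_map size_enum_ord.
  have := km_dim g; have := untwisted_rank _ _ theta thetav hA C.
  by rewrite -/A; lia.
have : (fullv <= lker mu)%VS.
  rewrite -full; apply/span_subvP => x; rewrite inE => /orP[/eqP ->|xX].
    by rewrite memv_ker; apply/eqP.
  by apply: (subvP (kerX _ mu0)); apply: memv_span.
by move=> ker; apply/lfunP => x; rewrite zero_lfunE; apply/eqP; rewrite -memv_ker (subvP ker) ?memvf.
Qed.

Variable Lam : 'I_(1 + l) -> dual_cartan g.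
Hypothesis hLam : fundamental_weights d Lam.
Let hQ := rational_weights Lam delta.

(** The Lambda_i and delta are dual to the coroots and d, and by [weight_eq0] these pairings
    determine a weight. *)
Lemma rational_weightsP (mu : dual_cartan g) :
  hQ mu <-> exists (c : 'I_(1 + l) -> rat) (b : rat),
    (forall i, pairing mu (km_coroot g i) = ratr (c i)) /\
    pairing mu d = ratr b.
Proof.
have [Lc Ld] := hLam.
have pc (c : 'I_(1 + l) -> rat) (b : rat) i :
    pairing (\sum_i (ratr (c i) : C) *: Lam i + (ratr b : C) *: delta)
      (km_coroot g i) = ratr (c i).
  rewrite pairingD pairingZ pairing_imaginary_root mulr0 addr0 pairing_sum.
  rewrite (bigD1 i) //= pairingZ Lc eqxx mulr1 big1 ?addr0 // => j /negPf ji.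
  by rewrite pairingZ Lc ji mulr0.
have pd (c : 'I_(1 + l) -> rat) (b : rat) :
    pairing (\sum_i (ratr (c i) : C) *: Lam i + (ratr b : C) *: delta) d = ratr b.
  rewrite pairingD pairingZ pairing_imaginary_derivation mulr1 pairing_sum.
  by rewrite big1 ?add0r // => j _; rewrite pairingZ Ld mulr0.
split=> [[c [b ->]]|[c [b [mc mb]]]]; first by exists c, b.
exists c, b; apply/eqP; rewrite -subr_eq0; apply/eqP.
apply: weight_eq0 => [i|]; first by rewrite pairingB pc mc subrr.
by rewrite pairingB pd mb subrr.
Qed.

Lemma rational_weights_lin (t : rat) u v :
  hQ u -> hQ v -> hQ ((ratr t : C) *: u + v).
Proof.
move=> /rational_weightsP[c [b [uc ub]]] /rational_weightsP[c' [b' [vc vb]]].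
apply/rational_weightsP; exists (fun i => t * c i + c' i), (t * b + b'); split=> [i|].
  by rewrite pairingD pairingZ uc vc rmorphD rmorphM.
by rewrite pairingD pairingZ ub vb rmorphD rmorphM.
Qed.

Lemma rational_weights_root j : hQ (km_root g j).
Proof.
apply/rational_weightsP; exists (fun i => (A i j)%:~R), (j == lshift l 0)%:R.
split=> [i|]; first by rewrite /pairing km_pairing ratr_int.
by rewrite hd ratr_nat.
Qed.

Lemma rational_weights_comb (c : 'I_(1 + l) -> rat) v : hQ v -> hQ (rcomb c + v).
Proof.
move=> hv; rewrite /rcomb /root_comb.
elim: (index_enum _) => [|j r IH]; first by rewrite big_nil add0r.
rewrite big_cons -addrA; apply: rational_weights_lin IH.
exact: rational_weights_root.
Qed.

Lemma rational_linear_comb f (c : 'I_(1 + l) -> rat) v :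
  rational_linear_on hQ f -> hQ v ->
  f (rcomb c + v) = \sum_j c j * f (km_root g j) + f v.
Proof.
move=> hf hv.
(* The functional is linear only on h^*_Q, so membership is carried along the induction. *)
suff [_ ->//] : hQ (rcomb c + v) /\
    f (rcomb c + v) = \sum_j c j * f (km_root g j) + f v.
rewrite /rcomb /root_comb; elim: (index_enum _) => [|j r [IH1 IH2]].
  by rewrite !big_nil !add0r.
have hj := rational_weights_root j.
rewrite !big_cons -!addrA; split; first exact: rational_weights_lin.
by rewrite hf // IH2.
Qed.

Variables (lambda : dual_cartan g) (m : 'cV[int]_(1 + l)).
Hypothesis mE : forall i, pairing lambda (km_coroot g i) = (m i 0)%:~R.
Hypothesis m0 : forall i, 0 < m i 0.
Hypothesis hlambda : pairing lambda d = 0.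
Let P := dominant_weight_polyhedron hQ lambda.

Lemma rational_weights_lambda : hQ lambda.
Proof.
apply/rational_weightsP; exists (fun i => (m i 0)%:~R), 0.
by split=> [i|]; rewrite ?mE ?ratr_int // hlambda rmorph0.
Qed.

Lemma subr_rcomb (c : 'I_(1 + l) -> rat) v : v - rcomb c = rcomb (fun j => - c j) + v.
Proof.
rewrite addrC; congr (_ + _); rewrite /rcomb -scaleN1r -root_combZ.
by apply: eq_root_comb => j; rewrite rmorphN mulN1r.
Qed.

Lemma pairing_subr_rcomb (c : 'I_(1 + l) -> rat) i :
  pairing (lambda - rcomb c) (km_coroot g i) =
  ratr ((m i 0)%:~R - \sum_j (A i j)%:~R * c j).
Proof. by rewrite pairingB mE pairing_root_comb_rat rmorphB /= ratr_int. Qed.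

(** Orbit points have nonnegative coordinates by [orbit_coord_ge0], and convex combinations preserve
    this. *)
Lemma conv_orbit_coord v : conv_rat (weyl_orbit lambda) v ->
  exists2 c : 'I_(1 + l) -> rat, forall j, 0 <= c j & v = lambda - rcomb c.
Proof.
have [e affA] := untwisted_affine_cartan _ _ _ _ hA htheta.
move=> [k [t [x [t0 t1 xO ->]]]].
have /choice[c cP] : forall i : 'I_k, exists c : 'cV[int]_(1 + l),
    (forall j, 0 <= c j 0) /\
    x i = lambda - root_comb C (1 + l) A g (fun j => (c j 0)%:~R).
  move=> i; have [w [js _ ->] <-] := xO i.
  exists (orbit_coord _ A m js); split=> [j|].
    by apply: orbit_coord_ge0 affA _ _ _ _ => ?; apply: ltW.
  exact: weyl_word_orbit_coord.
exists (fun j => \sum_i t i * (c i j 0)%:~R) => [j|].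
  by apply: sumr_ge0 => i _; rewrite mulr_ge0 // ler0z; have [] := cP i.
have -> : rcomb (fun j => \sum_i t i * (c i j 0)%:~R) =
    \sum_i (ratr (t i) : C) *: root_comb C (1 + l) A g (fun j => (c i j 0)%:~R).
  under [RHS]eq_bigr do rewrite -root_combZ.
  rewrite -root_comb_sum; apply: eq_root_comb => j; rewrite rmorph_sum.
  by apply: eq_bigr => i _; rewrite rmorphM /= ratr_int.
have -> : lambda = \sum_i (ratr (t i) : C) *: lambda.
  by rewrite -scaler_suml -rmorph_sum t1 rmorph1 scale1r.
rewrite -sumrB; apply: eq_bigr => i _; rewrite -scalerBr.
by congr (_ *: _); have [_] := cP i.
Qed.

(* lambda - k delta is the midpoint of s_0 s_theta lambda and
   s_theta s_0 lambda, where k is the level of lambda. *)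
Lemma conv_orbit_shift : exists2 k : rat, 0 < k &
  forall v, conv_rat (weyl_orbit lambda) v ->
    conv_rat (weyl_orbit lambda) (v - (ratr k : C) *: delta).
Proof.
have [e affA] := untwisted_affine_cartan _ _ _ _ hA htheta.
have A2 := cartan_diag _ _ _ affA.
have rt := root_coroot_untwisted _ _ theta thetav _ _ htheta.1.
have [js jsE] := reflection_word C _ _ g _ _ A2 rt.
set b := col_mx 0 theta in rt jsE; set bv := col_mx 0 thetav in rt jsE.
set Th := root_comb _ _ _ _ _ in jsE.
(* The pairing with theta^vee. *)
pose phi (mu : dual_cartan g) := \sum_i (bv i 0)%:~R * pairing mu (km_coroot g i).
have phiBZ u t v : phi (u - t *: v) = phi u - t * phi v.
  rewrite /phi mulr_sumr -sumrB; apply: eq_bigr => i _.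
  by rewrite pairingB pairingZ; ring.
set r0 := km_root g (lshift l 0).
have deltaE : delta = r0 + Th.
  rewrite /delta /basic_imaginary_root /Th /root_comb big_split_ord /= big_ord1.
  rewrite col_mxEu mxE scale0r add0r; congr (_ + _); apply: eq_bigr => i _.
  by rewrite col_mxEd.
have phiTh : phi Th = 2.
  rewrite /phi; under eq_bigr do rewrite pairing_root_comb_int -intrM.
  rewrite -rmorph_sum /=; have := root_pairing _ _ _ _ A2 rt.
  rewrite -mulmxA mxE => E; rewrite -[RHS]/(2%:~R) -[in RHS]E; congr (_%:~R).
  by apply: eq_bigr => i _; rewrite [bv^T _ _]mxE.
have phir0 : phi r0 = -2.
  have -> : r0 = delta - 1 *: Th by rewrite deltaE scale1r addrK.
  rewrite phiBZ phiTh mul1r /phi big1 ?sub0r // => i _.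
  by rewrite pairing_imaginary_root mulr0.
have r00 : pairing r0 (km_coroot g (lshift l 0)) = 2.
  by rewrite /pairing km_pairing A2.
have Th0 : pairing Th (km_coroot g (lshift l 0)) = - 2.
  have -> : Th = delta - r0 by rewrite deltaE addrAC subrr add0r.
  by rewrite pairingB pairing_imaginary_root r00 sub0r.
(* The level of lambda: its pairing with the central element alpha_0^vee + theta^vee. *)
pose K : int := m (lshift l 0) 0 + \sum_i bv i 0 * m i 0.
have K0 : 0 < K.
  apply: ltr_wpDr (m0 _); apply: sumr_ge0 => i _; apply: mulr_ge0 (ltW (m0 i)).
  case: (split_ordP i) => k ->; first by rewrite col_mxEu mxE.
  by rewrite col_mxEd ltW // (highest_coroot_gt0 _ _ _ _ hA htheta).
exists K%:~R; first by rewrite ltr0z.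
set x := phi lambda; set p0 := pairing lambda (km_coroot g (lshift l 0)).
have KE : ratr K%:~R = p0 + x :> C.
  rewrite ratr_int /K rmorphD rmorph_sum /= /p0 mE; congr (_ + _).
  by apply: eq_bigr => i _; rewrite mE -intrM.
have t1E : weyl_word g (lshift l 0 :: js) lambda =
    lambda - x *: Th - (p0 + 2 * x) *: r0.
  have E : pairing (lambda - x *: Th) (km_coroot g (lshift l 0)) = p0 + 2 * x.
    by rewrite pairingB pairingZ Th0 -/p0; ring.
  by rewrite weyl_word_cons jsE -/(phi lambda) -/x reflectionE E.
have t2E : weyl_word g (js ++ [:: lshift l 0]) lambda =
    lambda - p0 *: r0 - (x + 2 * p0) *: Th.
  rewrite weyl_word_cat [weyl_word g [:: _] lambda]weyl_word_cons id_lfunE reflectionE.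
  rewrite jsE -/(phi (lambda - p0 *: r0)) phiBZ phir0 -/x.
  by have -> : x - p0 * -2 = x + 2 * p0 by ring.
have mid : lambda - (p0 + x) *: delta =
    2^-1 *: weyl_word g (lshift l 0 :: js) lambda +
    2^-1 *: weyl_word g (js ++ [:: lshift l 0]) lambda.
  rewrite t1E t2E -scalerDr.
  have -> : lambda - x *: Th - (p0 + 2 * x) *: r0 +
      (lambda - p0 *: r0 - (x + 2 * p0) *: Th) =
      2 *: (lambda - (p0 + x) *: delta).
    rewrite [lambda - p0 *: r0 - _]addrAC addrACA [lambda - _ + _]addrACA.
    rewrite -!opprD -!scalerDl deltaE scalerBr scalerA scalerDr [in RHS]opprD.
    have -> : x + (x + 2 * p0) = 2 * (p0 + x) by ring.
    have -> : p0 + 2 * x + p0 = 2 * (p0 + x) by ring.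
    by rewrite scaler_nat mulr2n -addrA [- _ - _]addrC.
  by rewrite scalerA mulVf ?scale1r // pnatr_eq0.
(* The Weyl group fixes delta, so the midpoint formula transports to every orbit point y_i: the
   combination is doubled, each weight t_i being split into two halves. *)
move=> v [k [t [y [t0 t1 yO ->]]]].
have /choice[w wP] : forall i : 'I_k, exists ws, y i = weyl_word g ws lambda.
  by move=> i; have [_ [ws _ ->] <-] := yO i; exists ws.
pose c (i : 'I_(k + k)) : rat :=
  match fintype.split i with inl j => t j / 2 | inr j => t j / 2 end.
pose z (i : 'I_(k + k)) : dual_cartan g :=
  match fintype.split i with
  | inl j => weyl_word g (w j ++ (lshift l 0 :: js)) lambda
  | inr j => weyl_word g (w j ++ (js ++ [:: lshift l 0])) lambda
  end.
have cl i : c (lshift k i) = t i / 2 by rewrite /c -/(unsplit (inl i)) unsplitK.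
have cr i : c (rshift k i) = t i / 2 by rewrite /c -/(unsplit (inr i)) unsplitK.
have zl i : z (lshift k i) = weyl_word g (w i ++ (lshift l 0 :: js)) lambda.
  by rewrite /z -/(unsplit (inl i)) unsplitK.
have zr i : z (rshift k i) = weyl_word g (w i ++ (js ++ [:: lshift l 0])) lambda.
  by rewrite /z -/(unsplit (inr i)) unsplitK.
exists (k + k)%N, c, z; split.
- by move=> i; rewrite /c; case: fintype.split => j; rewrite divr_ge0.
- rewrite big_split_ord /=; under eq_bigr do rewrite cl.
  under [X in _ + X]eq_bigr do rewrite cr.
  by rewrite -!mulr_suml t1; lra.
- by move=> i; rewrite /z; case: fintype.split => j; apply: weyl_orbit_word.
rewrite big_split_ord /= -big_split /=.
have -> : (ratr K%:~R : C) *: delta = \sum_i (ratr (t i) : C) *: (ratr K%:~R *: delta).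
  by rewrite -scaler_suml -rmorph_sum t1 rmorph1 scale1r.
rewrite -sumrB; apply: eq_bigr => i _.
rewrite cl cr zl zr !(weyl_word_cat _ _ _ _ (w i)) rmorphM fmorphV /= ratr_nat.
have := weyl_word_fixed _ _ _ g (w i) delta pairing_imaginary_root.
rewrite wP KE; move: mid; move: (weyl_word g (w i)) (delta) => W D.
move: (weyl_word g _ lambda) (weyl_word g _ lambda) => T1 T2 mid WD.
have WE := congr1 W mid; rewrite linearB linearD !linearZ /= WD scalerN in WE.
by rewrite -scalerBr WE scalerDr !scalerA.
Qed.

(** * The two inclusions between vertices and averages *)

Section Vertex.
Variables (e : 'I_(1 + l) -> rat) (affA : affine_cartan A e marks).
Let affS := affine_symform affA.

(** On H the coordinates satisfy A c = m, so monotonicity gives c >= 0. Off H the coordinate c_j is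
    0, so (A c)_j involves only off-diagonal entries and is at most 0 < m_j, which gives
    dominance. *)
Lemma bhat_polyhedron (H : {set 'I_(1 + l)}) : (exists j, j \notin H) ->
  exists c : 'I_(1 + l) -> rat,
    [/\ supported H c, bhat H lambda = lambda - rcomb c,
        forall j, j \in H -> \sum_k (A j k)%:~R * c k = (m j 0)%:~R
      & P (bhat H lambda)].
Proof.
move=> pH; have [c [cH bE b0 bconv]] := bhat_coord C _ _ g _ _ affA H pH m lambda mE.
have cE j : j \in H -> \sum_k (A j k)%:~R * c k = (m j 0)%:~R.
  move=> jH; have := b0 j jH; rewrite bE pairing_subr_rcomb => /eqP.
  by rewrite fmorph_eq0 subr_eq0 => /eqP.
have c0 : forall j, 0 <= c j.
  apply: (mxapp_monotone _ _ _ affS H) => // j jH.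
  rewrite mxapp_symform cE // mulr_ge0 ?ler0z ?ltW //.
  exact: symmetrizer_gt0 affA j.
exists c; split=> //; split=> //; split.
  by rewrite bE subr_rcomb; apply: rational_weights_comb rational_weights_lambda.
move=> j; rewrite bE pairing_subr_rcomb ler0q.
have [jH|jH] := boolP (j \in H); first by rewrite cE // subrr.
rewrite subr_ge0; apply: (@le_trans _ _ 0); last by rewrite ler0z ltW.
apply: sumr_le0 => k _; have [kj|jk] := eqVneq j k.
  by rewrite -kj cH ?mulr0.
by rewrite mulr_le0_ge0 // lerz0 (cartan_off _ _ _ affA).
Qed.

Lemma polyhedron_coord x : P x -> exists c : 'I_(1 + l) -> rat,
  [/\ x = lambda - rcomb c, forall j, 0 <= c j
    & forall j, \sum_k (A j k)%:~R * c k <= (m j 0)%:~R].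
Proof.
move=> [[_ xdom] /conv_orbit_coord[c c0 xE]]; exists c; split=> // j.
by have := xdom j; rewrite xE pairing_subr_rcomb ler0q subr_ge0.
Qed.

(** Linear programming duality: the complementarity solution z is a dual certificate that bhat_H
    maximizes f under c >= 0 and A c <= m, while v is the only maximizer on the polyhedron. *)
Lemma vertex_is_bhat v : vertices hQ P v ->
  exists2 H : {set 'I_(1 + l)}, exists j, j \notin H & v = bhat H lambda.
Proof.
move=> [_ [f [M [flin fmax vE]]]].
have [Pv fv] : P v /\ f v = M by have : [set v] v by []; rewrite vE.
pose q j := f (km_root g j).
(* The sum is f(delta): shifting v by a negative multiple of delta stays in the polyhedron and so
   cannot increase f. *)
have qmarks : 0 <= \sum_j q j * marks j.
  have [k k0 kP] := conv_orbit_shift.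
  have [[hv vdom] vconv] := Pv.
  have shiftE : v - (ratr k : C) *: delta = rcomb (fun j => - (k * marks j)) + v.
    rewrite -(subr_rcomb (fun j => k * marks j)) imaginary_root_comb; congr (_ - _).
    by rewrite /rcomb -root_combZ; apply: eq_root_comb => j; rewrite rmorphM.
  have Pv' : P (v - (ratr k : C) *: delta).
    split; last exact: kP; split; first by rewrite shiftE; apply: rational_weights_comb.
    by move=> i; rewrite pairingB pairingZ pairing_imaginary_root mulr0 subr0.
  have := fmax _ Pv'; rewrite shiftE rational_linear_comb // fv gerDr.
  have -> : \sum_j - (k * marks j) * f (km_root g j) = - (k * \sum_j q j * marks j).
    by rewrite mulr_sumr -sumrN; apply: eq_bigr => j _; rewrite /q; ring.
  by rewrite oppr_le0 pmulr_rge0.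
have [//|H [z [pH zH z0 yH y0]]] := complementarity _ _ _ affS q _ qmarks.
exists H => //.
have [c [cH bE cE Pb]] := bhat_polyhedron H pH.
have fE c' : f (lambda - rcomb c') = f lambda - \sum_j c' j * q j.
  rewrite subr_rcomb rational_linear_comb //; last exact: rational_weights_lambda.
  by rewrite addrC -sumrN; congr (_ + _); apply: eq_bigr => j _; rewrite mulNr.
have qE c' : \sum_j c' j * q j =
    \sum_j (q j + mxapp (symform A e) z j) * c' j -
    \sum_j z j * (e j * \sum_k (A j k)%:~R * c' k).
  have -> : \sum_j z j * (e j * \sum_k (A j k)%:~R * c' k) =
      mxform (symform A e) z c'.
    by apply: eq_bigr => j _; rewrite mxapp_symform.
  rewrite (mxformC _ _ _ affS) /mxform -sumrB; apply: eq_bigr => j _.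
  by ring.
have [c' [vE' c'0 c'm]] := polyhedron_coord v Pv.
(* Complementary slackness: q + S z vanishes on H and c off H, while z vanishes off H and A c = m on
   H. So bhat_H is at least as good as v in both terms of [qE]. *)
have fb : f v <= f (bhat H lambda).
  rewrite vE' bE !fE lerD2l lerN2 !qE lerB //.
    rewrite big1 => [|j _]; first by apply: sumr_ge0 => j _; rewrite mulr_ge0.
    by have [jH|jH] := boolP (j \in H); [rewrite yH ?mul0r|rewrite cH ?mulr0].
  apply: ler_sum => j _; have [jH|jH] := boolP (j \in H); last first.
    by rewrite zH ?mul0r.
  rewrite cE // ler_wpM2l // ler_wpM2l //.
  exact: ltW (symmetrizer_gt0 _ _ _ affA j).
have : [set v] (bhat H lambda).
  by rewrite vE; split=> //; apply/le_anti; rewrite -[in M <= _]fv fb fmax.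
by [].
Qed.

(** The exposing functional equals a constant minus the sum of the slacks [G]: c_j off H and m_j -
    (A c)_j on H. The slacks are nonnegative on the polyhedron, and all vanish only at bhat_H. *)
Lemma bhat_is_vertex (H : {set 'I_(1 + l)}) : (exists j, j \notin H) ->
  vertices hQ P (bhat H lambda).
Proof.
move=> pH; have [c [cH bE cE Pb]] := bhat_polyhedron H pH.
(* A face functional is a function on all complex weights, so rational values are read off by
   choice, with 0 at non-rational numbers. *)
pose ratC (z : C) : rat := xget 0 [set q | z = ratr q].
have ratCK q : ratC (ratr q) = q.
  have : [set q' | ratr q = ratr q' :> C] (ratC (ratr q)).
    by apply: xgetPex; exists q.
  by move=> /= /fmorph_inj.
(* The indicator r of the complement of H must come from pairings with the coroots and d. Here u
   solves S u = r away from node 0; pairing with the null vector gives the defect t at node 0, which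
   d absorbs. *)
have [|u uH uE] := mxapp_solve _ _ _ affS [set~ lshift l 0]%SET
    (fun j => (j \notin H)%:R).
  by exists (lshift l 0); rewrite !inE eqxx.
pose r j : rat := (j \notin H)%:R.
pose t := \sum_j r j * marks j.
have rE j : r j = mxapp (symform A e) u j + t * (j == lshift l 0)%:R.
  have [->|j0] := eqVneq j (lshift l 0); last first.
    by rewrite mulr0 addr0 uE // !inE.
  have := mxform_null _ _ _ affS u; rewrite /mxform.
  rewrite (bigD1 (lshift l 0)) //= /marks affine_marks0 mul1r -/marks => E.
  rewrite mulr1 /t (bigD1 (lshift l 0)) //= /marks affine_marks0 mulr1 -/marks.
  move: E; under eq_bigr => k k0 do rewrite uE ?inE // mulrC.
  by rewrite -/r; lra.
pose f (mu : dual_cartan g) : rat :=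
  \sum_i (u i * e i - (i \in H)%:R) * ratC (pairing mu (km_coroot g i)) +
  t * ratC (pairing mu d).
have fP (mu : dual_cartan g) (c' : 'I_(1 + l) -> rat) (b : rat) :
    (forall i, pairing mu (km_coroot g i) = ratr (c' i)) ->
    pairing mu d = ratr b ->
    f mu = \sum_i (u i * e i - (i \in H)%:R) * c' i + t * b.
  move=> mc mb; rewrite /f mb ratCK; congr (_ + _).
  by apply: eq_bigr => i _; rewrite mc ratCK.
have flin : rational_linear_on hQ f.
  move=> s x y /rational_weightsP[cx [bx [xc xb]]] /rational_weightsP[cy [b' [yc yb]]].
  rewrite (fP x _ _ xc xb) (fP y _ _ yc yb).
  rewrite (fP _ (fun i => s * cx i + cy i) (s * bx + b')); last first.
  - by rewrite pairingD pairingZ xb yb rmorphD rmorphM.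
  - by move=> i; rewrite pairingD pairingZ xc yc rmorphD rmorphM.
  under eq_bigr do rewrite mulrDr mulrCA.
  by rewrite big_split /= -mulr_sumr; ring.
have froot j : f (km_root g j) = r j - \sum_(i in H) (A i j)%:~R.
  rewrite (fP _ (fun i => (A i j)%:~R) (j == lshift l 0)%:R); last first.
  - by rewrite hd ratr_nat.
  - by move=> i; rewrite /pairing km_pairing ratr_int.
  rewrite rE addrAC; congr (_ + _).
  rewrite [X in _ - X]big_mkcond -sumrB; apply: eq_bigr => i _.
  rewrite [symform _ _ _ _]mxE (cartan_sym _ _ _ affA j i).
  by move: (A i j) => z; case: (i \in H) => /=; ring.
pose G (c' : 'I_(1 + l) -> rat) j : rat :=
  if j \in H then (m j 0)%:~R - \sum_k (A j k)%:~R * c' k else c' j.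
pose M := f lambda + \sum_(i in H) (m i 0)%:~R.
have fE c' : f (lambda - rcomb c') = M - \sum_j G c' j.
  rewrite subr_rcomb rational_linear_comb //; last exact: rational_weights_lambda.
  have GE : \sum_j G c' j = \sum_j c' j * r j +
      \sum_(j in H) (m j 0)%:~R - \sum_(j in H) \sum_k (A j k)%:~R * c' k.
    rewrite -addrA -sumrB [X in _ + X]big_mkcond -big_split.
    by apply: eq_bigr => j _; rewrite /G /r; case: (j \in H) => /=; ring.
  have -> : \sum_j - c' j * f (km_root g j) =
      \sum_(j in H) \sum_k (A j k)%:~R * c' k - \sum_j c' j * r j.
    rewrite exchange_big -sumrB; apply: eq_bigr => j _ /=.
    by rewrite froot -mulr_suml; ring.
  by rewrite GE /M; ring.
split; first by exists (bhat H lambda).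
exists f, M; split=> //.
  move=> x /polyhedron_coord[c' [-> c'0 c'm]]; rewrite fE gerBl.
  by apply: sumr_ge0 => j _; rewrite /G; case: ifP; rewrite ?subr_ge0.
apply/seteqP; split=> x /= => [->|[Px fx]].
  split=> //; rewrite bE fE big1 ?subr0 // => j _; rewrite /G.
  by case: ifP => jH; rewrite ?cE ?subrr // cH ?jH.
have [c' [xE c'0 c'm]] := polyhedron_coord x Px.
have Gz : forall j, G c' j = 0.
  have /eqP : \sum_j G c' j = 0 by move: fx; rewrite xE fE; lra.
  rewrite psumr_eq0 => [/allP Gz j|j _]; last first.
    by rewrite /G; case: ifP; rewrite ?subr_ge0.
  by apply/eqP; have := Gz j (mem_index_enum _).
(* All slacks vanish, so c' - c is supported on H and S (c' - c) = 0 on H. *)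
have cc : forall j, c' j + (-1) * c j = 0.
  apply: (mxapp_inj _ _ _ affS H) => // [j jH|j jH].
    by have := Gz j; rewrite /G (negPf jH) cH // => ->; ring.
  have := Gz j; rewrite /G jH mxappDZ !mxapp_symform cE // => E.
  have -> : \sum_k (A j k)%:~R * c' k = (m j 0)%:~R by lra.
  by ring.
rewrite xE bE; congr (_ - _); apply: eq_root_comb => j; congr ratr.
by have := cc j; lra.
Qed.

End Vertex.
End DominantPolyhedron.

Theorem corollary3p10 (R : realType) (l : nat) (Afin : 'M[int]_l)
    (theta thetav : 'cV[int]_l)
    (hA : simple_cartan_matrix Afin)
    (htheta : highest_root Afin theta thetav)
    (g : kac_moody (complex R) (untwisted_affine_matrix Afin theta thetav))
    (d : km_cartan g) (hd : is_derivation_element d)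
    (Lam : 'I_(1 + l) -> dual_cartan g) (hLam : fundamental_weights d Lam)
    (lambda : dual_cartan g)
    (hdom : dominant_integral lambda) (hreg : regular_dominant lambda)
    (hlambda : pairing lambda d = 0) :
  let hQ := rational_weights Lam (basic_imaginary_root g) in
  vertices hQ (dominant_weight_polyhedron hQ lambda) =
  [set bhat H lambda | H in [set H : {set 'I_(1 + l)} | H \proper 'I_(1 + l)]].
Proof.
have [m' m'E] := choice hdom.
pose m : 'cV[int]_(1 + l) := \col_i (m' i)%:Z.
have mE i : pairing lambda (km_coroot g i) = (m i 0)%:~R by rewrite mxE m'E.
have m0 i : 0 < m i 0 by have := hreg i; rewrite mxE m'E ltr0n.
have [e affA] := untwisted_affine_cartan _ _ _ _ hA htheta.
move=> hQ; apply/seteqP; split=> [v vP|_ [H /properP[_ [j _ jH]] <-]].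
  have [H [j jH] ->] := vertex_is_bhat _ _ _ _ _ hA htheta _ _ hd _ hLam _ _ mE m0
    hlambda _ affA _ vP.
  by exists H => //=; apply/properP; split; [apply/fintype.subsetP|exists j].
by apply: (bhat_is_vertex _ _ _ _ _ hA htheta _ _ hd _ hLam _ m) affA _ _ => //; exists j.
Qed.
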